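(* Let $\mathcal{A}$ be an abelian category with subcategories $\mathcal{W}\subseteq\mathcal{X}$ and $\mathcal{V}\subseteq\mathcal{Y}$ such that $\mathcal{X}\perp\mathcal{W}$ and $\mathcal{V}\perp\mathcal{Y}$. Let $M$ and $N$ be objects in $\mathcal{A}$. (a) If $M$ is in $\operatorname{res}\widetilde{\mathcal{X}}\cap\operatorname{res}\widetilde{\mathcal{W}}$ and $N$ is in $\operatorname{res}\widehat{\mathcal{W}}$, then the natural map $\vartheta^n_{\mathcal{X}\mathcal{W}\mathcal{A}}(M,N)\colon\operatorname{Ext}^n_{\mathcal{X}\mathcal{A}}(M,N)\to\operatorname{Ext}^n_{\mathcal{W}\mathcal{A}}(M,N)$ is an isomorphism for each $n$. (b) If $M$ is in $\operatorname{cores}\widehat{\mathcal{V}}$ and $N$ is in $\operatorname{cores}\widetilde{\mathcal{Y}}\cap\operatorname{cores}\widetilde{\mathcal{V}}$, then the natural map $\vartheta^n_{\mathcal{A}\mathcal{Y}\mathcal{V}}(M,N)\colon\operatorname{Ext}^n_{\mathcal{A}\mathcal{Y}}(M,N)\to\operatorname{Ext}^n_{\mathcal{A}\mathcal{V}}(M,N)$ is an isomorphism for each $n$.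
   Context: ''Subcategory'' means full, additive subcategory closed under isomorphisms. For classes $\mathcal{C},\mathcal{D}$ of objects, $\mathcal{C}\perp\mathcal{D}$ means $\operatorname{Ext}^i_{\mathcal{A}}(C,D)=0$ for all $i\geq1$, $C\in\mathcal{C}$, $D\in\mathcal{D}$. Complexes are indexed homologically. For a subcategory $\mathcal{C}$, a $\mathcal{C}$-resolution of $M$ is a complex $C$ of objects of $\mathcal{C}$ with $C_n=0$ for $n<0$, $\operatorname{H}_n(C)=0$ for $n>0$ and $\operatorname{H}_0(C)\cong M$; its augmented resolution is $C^+=\cdots\to C_1\to C_0\to M\to0$. It is proper if $\operatorname{Hom}_{\mathcal{A}}(C',C^+)$ is exact for every $C'\in\mathcal{C}$. $\operatorname{res}\widehat{\mathcal{C}}$ (resp. $\operatorname{res}\widetilde{\mathcal{C}}$) is the subcategory of objects having a bounded (resp. proper) $\mathcal{C}$-resolution. Dually, a $\mathcal{C}$-coresolution of $N$ is a complex $C$ of objects of $\mathcal{C}$ with $C_n=0$ for $n>0$, $\operatorname{H}_n(C)=0$ for $n<0$ and $\operatorname{H}_0(C)\cong N$, with augmented coresolution ${}^+C=0\to N\to C_0\to C_{-1}\to\cdots$; it is proper if $\operatorname{Hom}_{\mathcal{A}}({}^+C,C')$ is exact for every $C'\in\mathcal{C}$. $\operatorname{cores}\widehat{\mathcal{C}}$ (resp. $\operatorname{cores}\widetilde{\mathcal{C}}$) is the subcategory of objects having a bounded (resp. proper) $\mathcal{C}$-coresolution. If $M$ has a proper $\mathcal{C}$-resolution $C\to M$,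 then $\operatorname{Ext}^n_{\mathcal{C}\mathcal{A}}(M,N)=\operatorname{H}_{-n}(\operatorname{Hom}_{\mathcal{A}}(C,N))$. If $N$ has a proper $\mathcal{C}$-coresolution $N\to C$, then $\operatorname{Ext}^n_{\mathcal{A}\mathcal{C}}(M,N)=\operatorname{H}_{-n}(\operatorname{Hom}_{\mathcal{A}}(M,C))$. These are independent of choices. Comparison maps: if $M$ has a proper $\mathcal{W}$-resolution $\gamma\colon W\to M$ and a proper $\mathcal{X}$-resolution $\gamma'\colon X\to M$, there is a morphism $\overline{\operatorname{id}_M}\colon W\to X$, unique up to homotopy (and a quasiisomorphism), with $\gamma=\gamma'\,\overline{\operatorname{id}_M}$; then $\vartheta^n_{\mathcal{X}\mathcal{W}\mathcal{A}}(M,N)=\operatorname{H}_{-n}(\operatorname{Hom}_{\mathcal{A}}(\overline{\operatorname{id}_M},N))$. If $N$ has a proper $\mathcal{Y}$-coresolution $\delta\colon N\to Y$ and a proper $\mathcal{V}$-coresolution $\delta'\colon N\to V$, there is a morphism $\overline{\operatorname{id}_N}\colon Y\to V$, unique up to homotopy (and a quasiisomorphism), with $\delta'=\overline{\operatorname{id}_N}\,\delta$; then $\vartheta^n_{\mathcal{A}\mathcal{Y}\mathcal{V}}(M,N)=\operatorname{H}_{-n}(\operatorname{Hom}_{\mathcal{A}}(M,\overline{\operatorname{id}_N}))$. *)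

(* Defs.v *)
From HB Require Import structures.
From Stdlib Require Import Relation_Operators.
From mathcomp Require Import all_boot all_order all_algebra.
From mathcomp Require Import generic_quotient ring_quotient boolp.

Set Implicit Arguments.
Unset Strict Implicit.
Unset Printing Implicit Defensive.

Import Order.TTheory GRing.Theory Num.Theory.
Local Open Scope ring_scope.
Local Open Scope quotient_scope.

(* Hom groups are [zmodType]s.  The decidable equality and the choice operator
   that this includes exist on every abelian group, by the classical axioms
   of [boolp]. *)
Record preadditiveCategory := PreadditiveCategory {
  object :> Type;
  hom : object -> object -> zmodType;
  idm : forall A, hom A A;
  mcomp : forall A B C, hom B C -> hom A B -> hom A C;
  mcompA : forall A B C D (h : hom C D) (g : hom B C) (f : hom A B),
    mcomp h (mcomp g f) = mcomp (mcomp h g) f;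
  mcomp1m : forall A B (f : hom A B), mcomp (idm B) f = f;
  mcompm1 : forall A B (f : hom A B), mcomp f (idm A) = f;
  mcompDl : forall A B C (g g' : hom B C) (f : hom A B),
    mcomp (g + g') f = mcomp g f + mcomp g' f;
  mcompDr : forall A B C (g : hom B C) (f f' : hom A B),
    mcomp g (f + f') = mcomp g f + mcomp g f'
}.

Arguments idm {p} A.
Arguments mcomp {p A B C} g f.

Notation "g \c f" := (mcomp g f) (at level 40, left associativity).

Section Preadditive.
Variable A : preadditiveCategory.
Implicit Types B C D K P T : A.

Lemma mcomp0m B C D (f : hom B C) : (0 : hom C D) \c f = 0.
Proof. by apply: (addrI (0 \c f)); rewrite -mcompDl !addr0. Qed.

Lemma mcompm0 B C D (g : hom C D) : g \c (0 : hom B C) = 0.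
Proof. by apply: (addrI (g \c 0)); rewrite -mcompDr !addr0. Qed.

Lemma mcompNm B C D (g : hom C D) (f : hom B C) : (- g) \c f = - (g \c f).
Proof. by apply: (addrI (g \c f)); rewrite -mcompDl !subrr mcomp0m. Qed.

Lemma mcompmN B C D (g : hom C D) (f : hom B C) : g \c (- f) = - (g \c f).
Proof. by apply: (addrI (g \c f)); rewrite -mcompDr !subrr mcompm0. Qed.

Definition is_isomorphism B C (f : hom B C) :=
  exists g : hom C B, g \c f = idm B /\ f \c g = idm C.

Definition isomorphic B C := exists f : hom B C, is_isomorphism f.

Definition mono B C (f : hom B C) :=
  forall T (g h : hom T B), f \c g = f \c h -> g = h.

Definition epi B C (f : hom B C) :=
  forall T (g h : hom C T), g \c f = h \c f -> g = h.

Definition is_zero B :=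
  (forall T (f : hom T B), f = 0) /\ (forall T (f : hom B T), f = 0).

Definition is_kernel B C K (g : hom B C) (k : hom K B) :=
  g \c k = 0 /\
  forall T (t : hom T B), g \c t = 0 -> exists! u : hom T K, k \c u = t.

Definition is_cokernel B C K (f : hom B C) (q : hom C K) :=
  q \c f = 0 /\
  forall T (t : hom C T), t \c f = 0 -> exists! u : hom K T, u \c q = t.

Definition is_biproduct B C P
    (i1 : hom B P) (i2 : hom C P) (p1 : hom P B) (p2 : hom P C) :=
  [/\ p1 \c i1 = idm B, p2 \c i2 = idm C, p1 \c i2 = 0, p2 \c i1 = 0
    & i1 \c p1 + i2 \c p2 = idm P].

Definition short_exact K B C (i : hom K B) (p : hom B C) :=
  is_kernel p i /\ is_cokernel i p.

(* [H] is the homology at [C] of [f : B -> C], [g : C -> D], i.e. the cokernel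
   of the map [f'] that [f] induces into the kernel [z : Z -> C] of [g]; the
   presentation consists of [z] and of the projection [p : Z -> H]. *)
Definition homology_presentation B C D Z H
    (f : hom B C) (g : hom C D) (z : hom Z C) (p : hom Z H) :=
  is_kernel g z /\ exists f' : hom B Z, z \c f' = f /\ is_cokernel f' p.

End Preadditive.

Record abelianCategory := AbelianCategory {
  abelian_preadditive :> preadditiveCategory;
  zero_ob : abelian_preadditive;
  zero_obP : is_zero zero_ob;
  biproduct_exists : forall B C : abelian_preadditive,
    exists (P : abelian_preadditive) (i1 : hom B P) (i2 : hom C P)
           (p1 : hom P B) (p2 : hom P C), is_biproduct i1 i2 p1 p2;
  kernel_exists : forall (B C : abelian_preadditive) (f : hom B C),
    exists (K : abelian_preadditive) (k : hom K B), is_kernel f k;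
  cokernel_exists : forall (B C : abelian_preadditive) (f : hom B C),
    exists (K : abelian_preadditive) (q : hom C K), is_cokernel f q;
  mono_kernel : forall (B C : abelian_preadditive) (f : hom B C), mono f ->
    exists (D : abelian_preadditive) (g : hom C D), is_kernel g f;
  epi_cokernel : forall (B C : abelian_preadditive) (f : hom B C), epi f ->
    exists (D : abelian_preadditive) (g : hom D B), is_cokernel g f
}.

Arguments zero_ob {a}.

(* A full subcategory is given by its class of objects. *)
Record subcategory (A : abelianCategory) := Subcategory {
  sub_mem :> A -> Prop;
  sub_zero : sub_mem zero_ob;
  sub_biproduct : forall (B C P : A) (i1 : hom B P) (i2 : hom C P)
    (p1 : hom P B) (p2 : hom P C),
    is_biproduct i1 i2 p1 p2 -> sub_mem B -> sub_mem C -> sub_mem P;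
  sub_isomorphic : forall B C : A, isomorphic B C -> sub_mem B -> sub_mem C
}.

Definition subcat_incl (A : abelianCategory) (C D : subcategory A) :=
  forall B : A, C B -> D B.

Section Yoneda.
Variable A : abelianCategory.

Record ses (K C : A) := Ses {
  ses_mid : A;
  ses_inj : hom K ses_mid;
  ses_prj : hom ses_mid C;
  ses_exact : short_exact ses_inj ses_prj
}.

Definition ses_morphism K K' C C' (k : hom K K') (f : hom C C')
    (s : ses K C) (s' : ses K' C') :=
  exists g : hom (ses_mid s) (ses_mid s'),
    g \c ses_inj s = ses_inj s' \c k /\ ses_prj s' \c g = f \c ses_prj s.

(* [extension D n C] is the type of exact sequences
     0 -> D -> E_n -> ... -> E_0 -> C -> 0
   with n.+1 middle terms, each stored as the Yoneda composite of n.+1 short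
   exact sequences; beware of the shift, the class lies in Ext^(n.+1)(C, D). *)
Fixpoint extension (D : A) (n : nat) (C : A) : Type :=
  if n is n'.+1 then {K : A & (ses K C * extension D n' K)%type} else ses D C.

(* Morphisms of exact sequences that are the identity on [D] and [f] on the
   other end. *)
Fixpoint extension_morphism (D : A) (n : nat) :
    forall C C' : A, hom C C' -> extension D n C -> extension D n C' -> Prop :=
  match n return
    forall C C' : A, hom C C' -> extension D n C -> extension D n C' -> Prop
  with
  | 0 => fun C C' f e e' => ses_morphism (idm D) f e e'
  | n'.+1 => fun C C' f e e' => exists k : hom (projT1 e) (projT1 e'),
      ses_morphism k f (projT2 e).1 (projT2 e').1 /\
      extension_morphism k (projT2 e).2 (projT2 e').2
  end.

Definition yoneda_equiv (D : A) n (C : A) :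
    extension D n C -> extension D n C -> Prop :=
  clos_refl_sym_trans _ (extension_morphism (idm C)).

(* Ext^(n.+1)(C, D), the group of Yoneda classes, is zero: there is a single
   class. *)
Definition Ext_vanishes n (C D : A) :=
  forall e e' : extension D n C, yoneda_equiv e e'.

Definition perp (C D : subcategory A) :=
  forall (B E : A), C B -> D E -> forall n : nat, Ext_vanishes n B E.

End Yoneda.

(* All complexes are indexed by [int], homologically.  So that no transport
   between objects with equal indices is needed, there is a differential for
   each pair of indices; only those of degree -1 can be nonzero. *)
Record abComplex := AbComplex {
  ab_obj :> int -> zmodType;
  ab_diff : forall i j, {additive ab_obj i -> ab_obj j};
  ab_shape : forall i j, i != j + 1 -> forall x, ab_diff i j x = 0;
  ab_diffK : forall i j k x, ab_diff j k (ab_diff i j x) = 0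
}.

Definition ab_exact (G : abComplex) := forall (n : int) (x : G n),
  ab_diff G n (n - 1) x = 0 -> exists y : G (n + 1), ab_diff G (n + 1) n y = x.

Section Homology.
Variables (G : abComplex) (n : int).

Definition is_cycle : {pred G n} := fun x => ab_diff G n (n - 1) x == 0.

Lemma is_cycle_closed : zmod_closed is_cycle.
Proof.
split=> [|x y]; rewrite !unfold_in ?raddf0 // => /eqP x0 /eqP y0.
by rewrite raddfB x0 y0 subrr.
Qed.

HB.instance Definition _ := GRing.isZmodClosed.Build (G n) is_cycle is_cycle_closed.

Record hcycle := HCycle { hcycle_val : G n; hcycle_valP : hcycle_val \in is_cycle }.

HB.instance Definition _ := [isSub for hcycle_val].
HB.instance Definition _ := [Choice of hcycle by <:].
HB.instance Definition _ := [SubChoice_isSubZmodule of hcycle by <:].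

Definition is_boundary : {pred hcycle} :=
  fun x => `[< exists y : G (n + 1), ab_diff G (n + 1) n y = val x >].

Lemma is_boundary_closed : zmod_closed is_boundary.
Proof.
split=> [|x y]; rewrite !unfold_in.
  by apply/asboolP; exists 0; rewrite !raddf0.
move=> /asboolP[u ux] /asboolP[v vy]; apply/asboolP.
by exists (u - v); rewrite !raddfB ux vy.
Qed.

HB.instance Definition _ :=
  GRing.isZmodClosed.Build hcycle is_boundary is_boundary_closed.

Definition homology : zmodType := {ideal_quot is_boundary}.

End Homology.

Record abMap (G H : abComplex) := AbMap {
  ab_map :> forall n, {additive G n -> H n};
  ab_mapP : forall i j x, ab_map j (ab_diff G i j x) = ab_diff H i j (ab_map i x)
}.

Section HomologyMap.
Variables (G H : abComplex) (f : abMap G H) (n : int).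

Lemma hcycle_map_subproof (x : hcycle G n) : f n (val x) \in @is_cycle H n.
Proof.
have /eqP x0 := valP x.
by rewrite unfold_in -ab_mapP x0 raddf0.
Qed.

Definition hcycle_map (x : hcycle G n) : hcycle H n := HCycle (hcycle_map_subproof x).

Definition homology_fun (x : homology G n) : homology H n :=
  \pi_({ideal_quot @is_boundary H n}) (hcycle_map (repr x)).

Lemma homology_funE (x : hcycle G n) :
  homology_fun (\pi_({ideal_quot @is_boundary G n}) x) =
  \pi_({ideal_quot @is_boundary H n}) (hcycle_map x).
Proof.
apply/eqP; rewrite -Quotient.idealrBE unfold_in.
have : repr (\pi_({ideal_quot @is_boundary G n}) x) - x \in @is_boundary G n.
  by rewrite Quotient.idealrBE reprK.
rewrite unfold_in => /asboolP[y yE]; apply/asboolP; exists (f (n + 1) y).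
by rewrite -ab_mapP yE !raddfB.
Qed.

Lemma homology_fun_zmod_morphism : zmod_morphism homology_fun.
Proof.
move=> x y; rewrite -[x]reprK -[y]reprK -raddfB !homology_funE -raddfB.
by congr \pi; apply: val_inj; rewrite /= !raddfB.
Qed.

HB.instance Definition _ := GRing.isZmodMorphism.Build
  (homology G n) (homology H n) homology_fun homology_fun_zmod_morphism.

Definition homology_map : {additive homology G n -> homology H n} := homology_fun.

End HomologyMap.

Definition zmod_isomorphism (U V : zmodType) (f : {additive U -> V}) :=
  exists g : {additive V -> U}, cancel f g /\ cancel g f.

Record complex (A : abelianCategory) := Complex {
  cpx_obj :> int -> A;
  diff : forall i j, hom (cpx_obj i) (cpx_obj j);
  diff_shape : forall i j, i != j + 1 -> diff i j = 0;
  diffK : forall i j k, diff j k \c diff i j = 0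
}.

Record chainMap (A : abelianCategory) (C D : complex A) := ChainMap {
  chain_map :> forall n, hom (C n) (D n);
  chain_mapP : forall i j, chain_map j \c diff C i j = diff D i j \c chain_map i
}.

Definition bounded (A : abelianCategory) (C : complex A) :=
  exists m : int, forall n : int, m < `|n| -> is_zero (C n).

(* H_n(C) is isomorphic to [H]. *)
Definition has_homology (A : abelianCategory) (C : complex A) (n : int) (H : A) :=
  exists (Z : A) (z : hom Z (C n)) (p : hom Z H),
    homology_presentation (diff C (n + 1) n) (diff C n (n - 1)) z p.

Section HomComplex.
Variable A : abelianCategory.

Definition postcomp (B C D : A) (g : hom C D) (f : hom B C) : hom B D := g \c f.

Lemma postcomp_zmod_morphism B C D (g : hom C D) : zmod_morphism (@postcomp B C D g).
Proof. by move=> x y; rewrite /postcomp mcompDr mcompmN. Qed.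

HB.instance Definition _ B C D (g : hom C D) := GRing.isZmodMorphism.Build
  (hom B C) (hom B D) (@postcomp B C D g) (postcomp_zmod_morphism g).

Definition precomp (B C D : A) (f : hom B C) (g : hom C D) : hom B D := g \c f.

Lemma precomp_zmod_morphism B C D (f : hom B C) : zmod_morphism (@precomp B C D f).
Proof. by move=> x y; rewrite /precomp mcompDl mcompNm. Qed.

HB.instance Definition _ B C D (f : hom B C) := GRing.isZmodMorphism.Build
  (hom C D) (hom B D) (@precomp B C D f) (precomp_zmod_morphism f).

Lemma hom_to_shape (B : A) (C : complex A) (i j : int) : i != j + 1 ->
  forall x : hom B (C i), postcomp (diff C i j) x = 0.
Proof. by move=> ij x; rewrite /postcomp diff_shape // mcomp0m. Qed.

Lemma hom_to_diffK (B : A) (C : complex A) (i j k : int) (x : hom B (C i)) :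
  postcomp (diff C j k) (postcomp (diff C i j) x) = 0.
Proof. by rewrite /postcomp mcompA diffK mcomp0m. Qed.

Definition hom_to (B : A) (C : complex A) : abComplex :=
  @AbComplex (fun n => hom B (C n)) (fun i j => postcomp (diff C i j))
    (@hom_to_shape B C) (@hom_to_diffK B C).

Lemma hom_from_shape (C : complex A) (B : A) (i j : int) : i != j + 1 ->
  forall x : hom (C (- i)) B, precomp (diff C (- j) (- i)) x = 0.
Proof.
move=> ij x; rewrite /precomp diff_shape ?mcompm0 //.
by apply: contra ij => /eqP ji; rewrite -[j]opprK ji opprD opprK subrK.
Qed.

Lemma hom_from_diffK (C : complex A) (B : A) (i j k : int) (x : hom (C (- i)) B) :
  precomp (diff C (- k) (- j)) (precomp (diff C (- j) (- i)) x) = 0.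
Proof. by rewrite /precomp -mcompA diffK mcompm0. Qed.

(* Hom(C, B) has Hom(C_(-n), B) in degree n. *)
Definition hom_from (C : complex A) (B : A) : abComplex :=
  @AbComplex (fun n => hom (C (- n)) B) (fun i j => precomp (diff C (- j) (- i)))
    (@hom_from_shape C B) (@hom_from_diffK C B).

Lemma hom_to_mapP (B : A) (C D : complex A) (f : chainMap C D) (i j : int)
    (x : hom B (C i)) :
  postcomp (f j) (postcomp (diff C i j) x) = postcomp (diff D i j) (postcomp (f i) x).
Proof. by rewrite /postcomp !mcompA chain_mapP. Qed.

Definition hom_to_map (B : A) (C D : complex A) (f : chainMap C D) :
    abMap (hom_to B C) (hom_to B D) :=
  @AbMap (hom_to B C) (hom_to B D) (fun n => postcomp (f n)) (@hom_to_mapP B C D f).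

Lemma hom_from_mapP (C D : complex A) (f : chainMap C D) (B : A) (i j : int)
    (x : hom (D (- i)) B) :
  precomp (f (- j)) (precomp (diff D (- j) (- i)) x) =
  precomp (diff C (- j) (- i)) (precomp (f (- i)) x).
Proof. by rewrite /precomp -!mcompA chain_mapP. Qed.

Definition hom_from_map (C D : complex A) (f : chainMap C D) (B : A) :
    abMap (hom_from D B) (hom_from C B) :=
  @AbMap (hom_from D B) (hom_from C B) (fun n => precomp (f (- n)))
    (@hom_from_mapP C D f B).

End HomComplex.

Section Augmented.
Variables (A : abelianCategory) (C : complex A) (M : A).

(* ... -> C_1 -> C_0 -> M -> 0, with M in degree -1 *)
Section Left.
Variables (e : hom (C 0) M) (eK : e \c diff C 1 0 = 0).

Definition augmented_obj (n : int) : A :=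
  match n with Posz k => C (Posz k) | Negz 0 => M | Negz _ => zero_ob end.

Definition augmented_diff (i j : int) : hom (augmented_obj i) (augmented_obj j) :=
  match i, j return hom (augmented_obj i) (augmented_obj j) with
  | Posz k, Posz l => diff C (Posz k) (Posz l)
  | Posz k, Negz l =>
      match k, l return hom (augmented_obj (Posz k)) (augmented_obj (Negz l)) with
      | 0%N, 0%N => e
      | _, _ => 0
      end
  | _, _ => 0
  end.

Lemma augmented_shape i j : i != j + 1 -> augmented_diff i j = 0.
Proof.
by case: i j => [[|k]|k] [l|[|l]] //=; apply: diff_shape.
Qed.

Lemma augmented_diffK i j k : augmented_diff j k \c augmented_diff i j = 0.
Proof.
case: i j k => [i|i] [[|j]|j] [k|[|k]] //=; rewrite ?mcomp0m ?mcompm0 ?diffK //.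
have [-> //|i1] := eqVneq (Posz i) 1.
by rewrite diff_shape ?mcompm0.
Qed.

Definition augmented : complex A := Complex augmented_shape augmented_diffK.

End Left.

(* 0 -> M -> C_0 -> C_(-1) -> ..., with M in degree 1 *)
Section Right.
Variables (e : hom M (C 0)) (eK : diff C 0 (- 1) \c e = 0).

Definition coaugmented_obj (n : int) : A :=
  match n with
  | Negz k => C (Negz k) | Posz 0 => C 0 | Posz 1 => M | Posz _ => zero_ob
  end.

Definition coaugmented_diff (i j : int) :
    hom (coaugmented_obj i) (coaugmented_obj j) :=
  match i, j return hom (coaugmented_obj i) (coaugmented_obj j) with
  | Negz k, Negz l => diff C (Negz k) (Negz l)
  | Posz 0, Negz l => diff C 0 (Negz l)
  | Negz k, Posz 0 => diff C (Negz k) 0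
  | Posz 0, Posz 0 => diff C 0 0
  | Posz 1, Posz 0 => e
  | _, _ => 0
  end.

Lemma coaugmented_shape i j : i != j + 1 -> coaugmented_diff i j = 0.
Proof.
by case: i j => [[|[|k]]|k] [[|[|l]]|l] //= ?; rewrite diff_shape.
Qed.

Lemma coaugmented_diffK i j k : coaugmented_diff j k \c coaugmented_diff i j = 0.
Proof.
case: i j k => [[|[|i]]|i] [[|[|j]]|j] [[|[|k]]|k] //=;
  rewrite ?mcomp0m ?mcompm0 ?diffK //.
  by rewrite (@diff_shape _ C 0 0) ?mcomp0m.
have [-> //|k1] := eqVneq (Negz k) (- 1).
rewrite diff_shape ?mcomp0m //; apply: contra k1 => /eqP k1.
by rewrite -[Negz k](addrK 1) -k1 sub0r.
Qed.

Definition coaugmented : complex A := Complex coaugmented_shape coaugmented_diffK.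

End Right.
End Augmented.

Section Resolutions.
Variables (A : abelianCategory) (C : subcategory A).

(* [res_aug] is the augmentation [C_0 -> M]; [res_H0] says that the map
   H_0(C) -> M induced by it is an isomorphism. *)
Record resolution (M : A) := Resolution {
  res_cpx :> complex A;
  res_mem : forall n, C (res_cpx n);
  res_neg : forall n : int, n < 0 -> is_zero (res_cpx n);
  res_acyclic : forall n : int, 0 < n -> has_homology res_cpx n zero_ob;
  res_aug : hom (res_cpx 0) M;
  res_augK : res_aug \c diff res_cpx 1 0 = 0;
  res_H0 : exists (Z : A) (z : hom Z (res_cpx 0)),
    homology_presentation (diff res_cpx 1 0) (diff res_cpx 0 (- 1))
      z (res_aug \c z)
}.

Record proper_resolution (M : A) := ProperResolution {
  pres_res :> resolution M;
  pres_proper : forall B : A, C B ->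
    ab_exact (hom_to B (augmented (res_augK pres_res)))
}.

Definition res_hat (M : A) := exists R : resolution M, bounded R.
Definition res_tilde (M : A) := inhabited (proper_resolution M).

(* [cores_H0] says that the map N -> H_0(C) induced by [cores_aug : N -> C_0]
   is an isomorphism: [N] with projection [p] presents H_0(C), and the
   factorization [s] of [cores_aug] through the cycles satisfies [p \c s = 1]. *)
Record coresolution (N : A) := Coresolution {
  cores_cpx :> complex A;
  cores_mem : forall n, C (cores_cpx n);
  cores_pos : forall n : int, 0 < n -> is_zero (cores_cpx n);
  cores_acyclic : forall n : int, n < 0 -> has_homology cores_cpx n zero_ob;
  cores_aug : hom N (cores_cpx 0);
  cores_augK : diff cores_cpx 0 (- 1) \c cores_aug = 0;
  cores_H0 : exists (Z : A) (z : hom Z (cores_cpx 0)) (p : hom Z N) (s : hom N Z),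
    [/\ homology_presentation (diff cores_cpx 1 0) (diff cores_cpx 0 (- 1)) z p,
        z \c s = cores_aug & p \c s = idm N]
}.

Record proper_coresolution (N : A) := ProperCoresolution {
  pcores_cores :> coresolution N;
  pcores_proper : forall B : A, C B ->
    ab_exact (hom_from (coaugmented (cores_augK pcores_cores)) B)
}.

Definition cores_hat (N : A) := exists R : coresolution N, bounded R.
Definition cores_tilde (N : A) := inhabited (proper_coresolution N).

End Resolutions.

Arguments res_neg {A C M} r n _.
Arguments pres_proper {A C M} p B _.
Arguments cores_pos {A C N} c n _.
Arguments pcores_proper {A C N} p B _.

Section RelativeExt.
Variable A : abelianCategory.

(* Ext^n_{C A}(M, N), computed by a given proper C-resolution of M *)
Definition ext_res (C : subcategory A) (M : A) (R : proper_resolution C M)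
    (N : A) (n : int) : zmodType :=
  homology (hom_from R N) (- n).

(* Ext^n_{A C}(M, N), computed by a given proper C-coresolution of N *)
Definition ext_cores (C : subcategory A) (M N : A) (R : proper_coresolution C N)
    (n : int) : zmodType :=
  homology (hom_to M R) (- n).

Record comparison (W X : subcategory A) (M : A)
    (RW : proper_resolution W M) (RX : proper_resolution X M) := Comparison {
  cmp_map :> chainMap RW RX;
  cmp_aug : res_aug RX \c cmp_map 0 = res_aug RW
}.

Definition theta_res (W X : subcategory A) (M : A)
    (RW : proper_resolution W M) (RX : proper_resolution X M)
    (phi : comparison RW RX) (N : A) (n : int) :
    {additive ext_res RX N n -> ext_res RW N n} :=
  homology_map (hom_from_map phi N) (- n).

Record cocomparison (Y V : subcategory A) (N : A)
    (RY : proper_coresolution Y N) (RV : proper_coresolution V N) :=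
    Cocomparison {
  cocmp_map :> chainMap RY RV;
  cocmp_aug : cocmp_map 0 \c cores_aug RY = cores_aug RV
}.

Definition theta_cores (Y V : subcategory A) (M N : A)
    (RY : proper_coresolution Y N) (RV : proper_coresolution V N)
    (phi : cocomparison RY RV) (n : int) :
    {additive ext_cores M RY n -> ext_cores M RV n} :=
  homology_map (hom_to_map M phi) (- n).

End RelativeExt.

(* Not used in the definitions: these lemmas show that a quantification over
   all comparison maps between given resolutions is never vacuous. *)

Lemma comparison_exists (A : abelianCategory) (W X : subcategory A) (M : A)
    (RW : proper_resolution W M) (RX : proper_resolution X M) :
  subcat_incl W X -> inhabited (comparison RW RX).
Proof.
move=> sWX.
pose aW := augmented (res_augK RW); pose aX := augmented (res_augK RX).
pose d (k : nat) : hom (aX k%:Z) (aX (k%:Z - 1)) := diff aX k%:Z (k%:Z - 1).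
have lift (n : int) (k : nat) (f : hom (RW n) (aX k)) : d k \c f = 0 ->
    {g : hom (RW n) (aX k.+1) | diff aX k.+1 k \c g = f}.
  move=> df; apply: cid.
  have [g] := pres_proper RX _ (sWX _ (res_mem RW n)) _ _ df.
  have e : k%:Z + 1 = k.+1 by rewrite -addn1 PoszD.
  by case: _ / e g => g; exists g.
have [f0 f0E] : {f : hom (RW 0) (RX 0) | res_aug RX \c f = res_aug RW}.
  apply: cid.
  have := pres_proper RX _ (sWX _ (res_mem RW 0)) (- 1) (res_aug RW).
  by case=> [|g gE]; [rewrite /= /postcomp mcomp0m | exists g].
pose Q k (f : hom (RW k%:Z) (RX k%:Z)) := d k \c (f \c diff RW k.+1 k) = 0.
have Q0 : Q 0 f0 by rewrite /Q mcompA f0E (res_augK RW).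
have step k (f : {f | Q k f}) : {g : {g | Q k.+1 g} |
    diff RX k.+1 k \c proj1_sig g = proj1_sig f \c diff RW k.+1 k}.
  have [g gE] := lift _ _ _ (proj2_sig f).
  suff gQ : Q k.+1 g by exists (exist _ g gQ).
  rewrite /Q /d (_ : k.+1%:Z - 1 = k); last by rewrite -addn1 PoszD addrK.
  by rewrite mcompA gE -mcompA diffK mcompm0.
pose phiN := fix phiN k : {f | Q k f} :=
  if k is k'.+1 then proj1_sig (step k' (phiN k')) else exist _ f0 Q0.
pose phi (n : int) : hom (RW n) (RX n) :=
  if n is Posz k then proj1_sig (phiN k) else 0.
have phiP i j : phi j \c diff RW i j = diff RX i j \c phi i.
  have [->|ij] := eqVneq i (j + 1); last by rewrite !diff_shape // mcompm0 mcomp0m.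
  case: j => [k|k].
    rewrite (_ : k%:Z + 1 = k.+1); last by rewrite -addn1 PoszD.
    by rewrite /= (proj2_sig (step _ _)).
  have [z _] := res_neg RX (Negz k) isT.
  by rewrite [LHS]z [RHS]z.
by constructor; exists (ChainMap phiP).
Qed.

Lemma cocomparison_exists (A : abelianCategory) (V Y : subcategory A) (N : A)
    (RY : proper_coresolution Y N) (RV : proper_coresolution V N) :
  subcat_incl V Y -> inhabited (cocomparison RY RV).
Proof.
move=> sVY; pose aY := coaugmented (cores_augK RY).
have exa (n : int) (B : A) (f : hom (aY n) B) : Y B -> f \c diff aY (n + 1) n = 0 ->
    exists g : hom (aY (n - 1)) B, g \c diff aY n (n - 1) = f.
  move=> YB; have := pcores_proper RY B YB (- n).
  rewrite /= /precomp opprK (_ : - (- n - 1) = n + 1); last by rewrite opprD !opprK.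
  by rewrite (_ : - (- n + 1) = n - 1) 1?opprD ?opprK // => H /H.
pose cond k := match k return forall B, hom (RY (- k%:Z)) B -> Prop with
  | 0 => fun B f => f \c cores_aug RY = 0
  | k'.+1 => fun B f => f \c diff RY (- k'%:Z) (- k'.+1%:Z) = 0 end.
have lift k n (f : hom (RY (- k%:Z)) (RV n)) : cond k _ f ->
    {g : hom (RY (- k.+1%:Z)) (RV n) | g \c diff RY (- k%:Z) (- k.+1%:Z) = f}.
  move=> fc; apply: cid; have YV := sVY _ (cores_mem RV n).
  case: k => [|k] in f fc *; first exact: (exa 0 _ f YV fc).
  have := exa (Negz k) _ f YV.
  rewrite (_ : Negz k + 1 = - k%:Z); last by rewrite NegzE -addn1 PoszD opprD addrNK.
  rewrite (_ : Negz k - 1 = Negz k.+1); last by rewrite !NegzE -[in RHS]addn1 PoszD opprD.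
  by apply; case: k f fc.
have [f0 f0E] : {f : hom (RY 0) (RV 0) | f \c cores_aug RY = cores_aug RV}.
  apply: cid; have [||g gE] := exa 1 _ (cores_aug RV).
  - exact: sVY (cores_mem _ _).
  - by rewrite /= mcompm0.
  - by exists g.
pose Q k (f : hom (RY (- k%:Z)) (RV (- k%:Z))) :=
  cond k _ (diff RV (- k%:Z) (- k.+1%:Z) \c f).
have Q0 : Q 0 f0 by rewrite /Q /= -mcompA f0E (cores_augK RV).
have step k (f : {f | Q k f}) : {g : {g | Q k.+1 g} |
    proj1_sig g \c diff RY (- k%:Z) (- k.+1%:Z) =
    diff RV (- k%:Z) (- k.+1%:Z) \c proj1_sig f}.
  have [g gE] := lift _ _ _ (proj2_sig f).
  suff gQ : Q k.+1 g by exists (exist _ g gQ).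
  by rewrite /Q /cond -mcompA gE mcompA diffK mcomp0m.
pose phiN := fix phiN k : {f | Q k f} :=
  if k is k'.+1 then proj1_sig (step k' (phiN k')) else exist _ f0 Q0.
pose phi (n : int) : hom (RY n) (RV n) :=
  match n with
  | Negz k => proj1_sig (phiN k.+1) | Posz 0 => f0 | Posz _ => 0
  end.
have phiN_E k : phi (- k%:Z) = proj1_sig (phiN k) by case: k.
have phiP i j : phi j \c diff RY i j = diff RV i j \c phi i.
  have [->|ij] := eqVneq i (j + 1); last by rewrite !diff_shape // mcompm0 mcomp0m.
  case: j => [k|k].
    have [_ z] := cores_pos RY (k%:Z + 1) (ltn_addl k (ltn0Sn 0)).
    by rewrite [LHS]z [RHS]z.
  rewrite (_ : Negz k + 1 = - k%:Z); last by rewrite NegzE -addn1 PoszD opprD addrNK.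
  rewrite phiN_E; exact: (proj2_sig (step _ _)).
by constructor; exists (ChainMap phiP).
Qed.

(* Main.v *)
From HB Require Import structures.
From mathcomp Require Import all_boot all_order all_algebra.
From mathcomp Require Import generic_quotient ring_quotient boolp.
Require Import Defs.

Set Implicit Arguments.
Unset Strict Implicit.
Unset Printing Implicit Defensive.

Import Order.TTheory GRing.Theory Num.Theory.
Local Open Scope ring_scope.
Local Open Scope quotient_scope.

(** The cone of a comparison map is an exact complex of objects of X that is
   bounded below.  By dimension shifting, along the W-resolution of N and along
   the cone, Ext(-, N) vanishes on the syzygies of the cone, so Hom(-, N) keeps
   the cone exact and the comparison map induces isomorphisms in homology; part
   (b) is dual, with the cone in the second argument.

   No long exact sequence for Yoneda Ext is used.  An extension is trivial iff
   successive epimorphic covers kill it ([null]); this condition is invariant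
   under the morphisms that generate Yoneda equivalence, and the two dimension
   shifts that are needed follow from it by explicit constructions. *)

(** * Abelian categories *)

(** Yoneda equivalence is generated by morphisms taken in either direction, so the fact that all
    classes coincide gives no map to work with. What is needed is a property of a single extension
    that travels both ways along a morphism. [null] travels forward by composing lifts. Backward,
    two lifts differ by a map into a kernel, about which nothing is known; [null] asks for covers
    instead of splittings so that this discrepancy can be killed by refining the cover.

    Each dimension shift spends a vanishing in the next higher degree, so vanishing is always
    carried in all degrees at once. The two inductions start at opposite ends. Along the resolution
    of N one descends from the place where it has become zero, which is where boundedness enters.
    The cone may be infinite to the left, so there one climbs from its surjective end, where the
    last cokernel is zero. Injectivity and surjectivity in homology are then both instances of the
    exactness of Hom(cone, N), read in coordinates. *)

Section Abelian.
Variable A : abelianCategory.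
Implicit Types B C D K L P T X : A.

Lemma monoP B C (f : hom B C) :
  mono f <-> forall T (t : hom T B), f \c t = 0 -> t = 0.
Proof.
split=> [fm T t ft | f0 T g h fgh]; first by apply: fm; rewrite ft mcompm0.
by apply/eqP; rewrite -subr_eq0; apply/eqP/f0; rewrite mcompDr mcompmN fgh subrr.
Qed.

Lemma epiP B C (f : hom B C) :
  epi f <-> forall T (t : hom C T), t \c f = 0 -> t = 0.
Proof.
split=> [fe T t ft | f0 T g h fgh]; first by apply: fe; rewrite ft mcomp0m.
by apply/eqP; rewrite -subr_eq0; apply/eqP/f0; rewrite mcompDl mcompNm fgh subrr.
Qed.

Lemma mono0 B C T (f : hom B C) (t : hom T B) : mono f -> f \c t = 0 -> t = 0.
Proof. by move/monoP; apply. Qed.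

Lemma epi0 B C T (f : hom B C) (t : hom C T) : epi f -> t \c f = 0 -> t = 0.
Proof. by move/epiP; apply. Qed.

Lemma epi_id B : epi (idm B).
Proof. by move=> T g h; rewrite !mcompm1. Qed.

Lemma epi_comp B C D (g : hom C D) (f : hom B C) : epi g -> epi f -> epi (g \c f).
Proof. by move=> ge fe T u v; rewrite !mcompA => /fe/ge. Qed.

Lemma epi_factor B C D (g : hom C D) (f : hom B C) : epi (g \c f) -> epi g.
Proof. by move=> gfe T u v uv; apply: gfe; rewrite !mcompA uv. Qed.

Lemma kernel_mono B C K (g : hom B C) (k : hom K B) : is_kernel g k -> mono k.
Proof.
case=> gk kU; apply/monoP => T t kt.
have [u [_ uU]] := kU T 0 (mcompm0 _ _).
by rewrite -(uU t kt) (uU 0) // mcompm0.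
Qed.

Lemma cokernel_epi B C K (f : hom B C) (q : hom C K) : is_cokernel f q -> epi q.
Proof.
case=> qf qU; apply/epiP => T t tq.
have [u [_ uU]] := qU T 0 (mcomp0m _ _).
by rewrite -(uU t tq) (uU 0) // mcomp0m.
Qed.

Lemma kernel_lift B C K T (g : hom B C) (k : hom K B) (t : hom T B) :
  is_kernel g k -> g \c t = 0 -> exists u, k \c u = t.
Proof. by case=> _ kU /kU[u [uE _]]; exists u. Qed.

Lemma cokernel_desc B C K T (f : hom B C) (q : hom C K) (t : hom C T) :
  is_cokernel f q -> t \c f = 0 -> exists u, u \c q = t.
Proof. by case=> _ qU /qU[u [uE _]]; exists u. Qed.

Lemma is_kernelI B C K (g : hom B C) (k : hom K B) :
  g \c k = 0 -> mono k ->
  (forall T (t : hom T B), g \c t = 0 -> exists u, k \c u = t) -> is_kernel g k.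
Proof.
move=> gk km kU; split=> // T t /kU[u uE]; exists u; split=> // v vE.
by apply: km; rewrite uE vE.
Qed.

Lemma is_cokernelI B C K (f : hom B C) (q : hom C K) :
  q \c f = 0 -> epi q ->
  (forall T (t : hom C T), t \c f = 0 -> exists u, u \c q = t) -> is_cokernel f q.
Proof.
move=> qf qe qU; split=> // T t /qU[u uE]; exists u; split=> // v vE.
by apply: qe; rewrite uE vE.
Qed.

Lemma epi_short_exact K B C (i : hom K B) (p : hom B C) :
  is_kernel p i -> epi p -> short_exact i p.
Proof.
move=> pi pe; split=> //; have [D [g [pg gU]]] := epi_cokernel pe.
apply: is_cokernelI (pi.1) pe _ => T t ti.
have [h hE] := kernel_lift pi pg.
by have [|u [uE _]] := gU T t; [rewrite -hE mcompA ti mcomp0m | exists u].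
Qed.

Lemma mono_short_exact K B C (i : hom K B) (p : hom B C) :
  is_cokernel i p -> mono i -> short_exact i p.
Proof.
move=> ip im; split=> //; have [D [g [gi gU]]] := mono_kernel im.
apply: is_kernelI (ip.1) im _ => T t pt.
have [h hE] := cokernel_desc ip gi.
by have [|u [uE _]] := gU T t; [rewrite -hE -mcompA pt mcompm0 | exists u].
Qed.

Section ShortExact.
Variables (K B C : A) (i : hom K B) (p : hom B C).
Hypothesis ip : short_exact i p.

Lemma se_mono : mono i. Proof. exact: kernel_mono ip.1. Qed.
Lemma se_epi : epi p. Proof. exact: cokernel_epi ip.2. Qed.
Lemma se0 : p \c i = 0. Proof. exact: ip.1.1. Qed.

Lemma se_lift T (t : hom T B) : p \c t = 0 -> exists u, i \c u = t.
Proof. exact: kernel_lift ip.1. Qed.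

Lemma se_desc T (t : hom B T) : t \c i = 0 -> exists u, u \c p = t.
Proof. exact: cokernel_desc ip.2. Qed.

End ShortExact.

Lemma epi_kernel B C (p : hom B C) :
  epi p -> exists K (i : hom K B), short_exact i p.
Proof.
by move=> pe; have [K [i pi]] := kernel_exists p; exists K, i; apply: epi_short_exact.
Qed.

Lemma zero_short_exact B C (p : hom B C) : mono p -> epi p ->
  short_exact (0 : hom zero_ob B) p.
Proof.
move=> pm pe; have [zt zf] := zero_obP A.
apply: epi_short_exact => //; apply: is_kernelI.
- exact: mcompm0.
- by move=> T g h _; rewrite (zt _ g) (zt _ h).
- by move=> T t /(mono0 pm)->; exists 0; rewrite mcompm0.
Qed.

Lemma short_exact_zero K B (i : hom K B) : mono i -> epi i ->
  short_exact i (0 : hom B zero_ob).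
Proof.
move=> im ie; have [zt zf] := zero_obP A.
apply: mono_short_exact => //; apply: is_cokernelI.
- exact: mcomp0m.
- by move=> T g h _; rewrite (zf _ g) (zf _ h).
- by move=> T t /(epi0 ie)->; exists 0; rewrite mcomp0m.
Qed.

Section Biproduct.
Variables (B C P : A) (i1 : hom B P) (i2 : hom C P) (p1 : hom P B) (p2 : hom P C).
Hypothesis bi : is_biproduct i1 i2 p1 p2.

Lemma biproduct_eta_to T (t : hom T P) : t = i1 \c (p1 \c t) + i2 \c (p2 \c t).
Proof. by case: bi => _ _ _ _ e; rewrite !mcompA -mcompDl e mcomp1m. Qed.

Lemma biproduct_eta_from T (t : hom P T) : t = t \c i1 \c p1 + t \c i2 \c p2.
Proof. by case: bi => _ _ _ _ e; rewrite -!mcompA -mcompDr e mcompm1. Qed.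

Lemma biproduct_p1 T (x : hom T B) (y : hom T C) : p1 \c (i1 \c x + i2 \c y) = x.
Proof.
by case: bi => e1 _ e2 _ _; rewrite mcompDr !mcompA e1 e2 mcomp1m mcomp0m addr0.
Qed.

Lemma biproduct_p2 T (x : hom T B) (y : hom T C) : p2 \c (i1 \c x + i2 \c y) = y.
Proof.
by case: bi => _ e1 _ e2 _; rewrite mcompDr !mcompA e1 e2 mcomp1m mcomp0m add0r.
Qed.

Lemma biproduct_i1 T (x : hom B T) (y : hom C T) : (x \c p1 + y \c p2) \c i1 = x.
Proof.
by case: bi => e1 _ _ e2 _; rewrite mcompDl -!mcompA e1 e2 mcompm1 mcompm0 addr0.
Qed.

Lemma biproduct_i2 T (x : hom B T) (y : hom C T) : (x \c p1 + y \c p2) \c i2 = y.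
Proof.
by case: bi => _ e1 e2 _ _; rewrite mcompDl -!mcompA e1 e2 mcompm1 mcompm0 add0r.
Qed.

End Biproduct.

(** The pullback is the kernel of [f \c p1 - p \c p2]. This map is epi because [p] is, hence it is
    the cokernel of its kernel. A map [w] killing [a] therefore gives
    [w \c p1 = v \c (f \c p1 - p \c p2)]; restriction to the second summand forces [v = 0], and
    restriction to the first then gives [w = 0]. *)
Lemma pullback_epi B C T (p : hom B C) (f : hom T C) : epi p ->
  exists P (a : hom P T) (b : hom P B), [/\ epi a, f \c a = p \c b,
    forall X (x : hom X P), a \c x = 0 -> b \c x = 0 -> x = 0 &
    forall X (x : hom X T) (y : hom X B), f \c x = p \c y ->
      exists u, a \c u = x /\ b \c u = y].
Proof.
move=> pe; have [S [i1 [i2 [p1 [p2 bi]]]]] := biproduct_exists T B.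
have [P [k hk]] := kernel_exists (f \c p1 - p \c p2).
have hE : f \c p1 - p \c p2 = f \c p1 + (- p) \c p2 by rewrite mcompNm.
have he : epi (f \c p1 - p \c p2).
  apply/epiP => X x /(congr1 (fun y => y \c i2)).
  rewrite hE -mcompA (biproduct_i2 bi) mcomp0m mcompmN => /eqP.
  by rewrite oppr_eq0 => /eqP/(epi0 pe).
exists P, (p1 \c k), (p2 \c k); split.
- apply/epiP => X w; rewrite mcompA => wk.
  have [v vE] := se_desc (epi_short_exact hk he) wk.
  have v0 : v = 0.
    apply: (epi0 pe); apply/eqP; rewrite -oppr_eq0 -mcompmN -(biproduct_i2 bi (f) (- p)).
    rewrite -hE mcompA vE -mcompA.
    by case: bi => _ _ -> _ _; rewrite mcompm0.
  have := congr1 (fun y => y \c i1) vE; rewrite v0 !mcomp0m -mcompA.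
  by case: bi => -> _ _ _ _; rewrite mcompm1.
- by apply/eqP; rewrite -subr_eq0 !mcompA -mcompNm -mcompDl hk.1.
- move=> X x; rewrite -!mcompA => x1 x2; apply: (mono0 (kernel_mono hk)).
  by rewrite [LHS](biproduct_eta_to bi) x1 x2 !mcompm0 addr0.
- move=> X x y xy; have [|u uE] := @kernel_lift _ _ _ _ _ _ (i1 \c x + i2 \c y) hk.
    by rewrite mcompDl mcompNm -!mcompA (biproduct_p1 bi) (biproduct_p2 bi) xy subrr.
  by exists u; rewrite -!mcompA uE (biproduct_p1 bi) (biproduct_p2 bi).
Qed.

Lemma pushout_mono B D K (i : hom K B) (g : hom K D) : mono i ->
  exists P (a : hom D P) (b : hom B P), [/\ mono a, a \c g = b \c i,
    forall X (x : hom P X), x \c a = 0 -> x \c b = 0 -> x = 0 &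
    forall X (x : hom D X) (y : hom B X), x \c g = y \c i ->
      exists u, u \c a = x /\ u \c b = y].
Proof.
move=> im; have [S [i1 [i2 [p1 [p2 bi]]]]] := biproduct_exists D B.
have [P [k hk]] := cokernel_exists (i1 \c g - i2 \c i).
have hE : i1 \c g - i2 \c i = i1 \c g + i2 \c (- i) by rewrite mcompmN.
have hm : mono (i1 \c g - i2 \c i).
  apply/monoP => X x /(congr1 (fun y => p2 \c y)).
  rewrite hE mcompA (biproduct_p2 bi) mcompm0 mcompNm => /eqP.
  by rewrite oppr_eq0 => /eqP/(mono0 im).
exists P, (k \c i1), (k \c i2); split.
- apply/monoP => X w; rewrite -mcompA => wk.
  have [v vE] := se_lift (mono_short_exact hk hm) wk.
  have v0 : v = 0.
    apply: (mono0 im); apply/eqP; rewrite -oppr_eq0 -mcompNm -(biproduct_p2 bi g (- i)).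
    rewrite -hE -mcompA vE mcompA.
    by case: bi => _ _ _ -> _; rewrite mcomp0m.
  have := congr1 (fun y => p1 \c y) vE; rewrite v0 !mcompm0 mcompA.
  by case: bi => -> _ _ _ _; rewrite mcomp1m.
- by apply/eqP; rewrite -subr_eq0 -!mcompA -mcompmN -mcompDr hk.1.
- move=> X x; rewrite !mcompA => x1 x2; apply: (epi0 (cokernel_epi hk)).
  by rewrite [LHS](biproduct_eta_from bi) x1 x2 !mcomp0m addr0.
- move=> X x y xy; have [|u uE] := @cokernel_desc _ _ _ _ _ _ (x \c p1 + y \c p2) hk.
    by rewrite mcompDr mcompmN !mcompA (biproduct_i1 bi) (biproduct_i2 bi) xy subrr.
  by exists u; rewrite !mcompA uE (biproduct_i1 bi) (biproduct_i2 bi).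
Qed.

Lemma ses_pullback K C T (s : ses K C) (f : hom T C) :
  exists (s' : ses K T) (m : hom (ses_mid s') (ses_mid s)),
  [/\ m \c ses_inj s' = ses_inj s, ses_prj s \c m = f \c ses_prj s' &
    forall X (x : hom X T) (y : hom X (ses_mid s)), f \c x = ses_prj s \c y ->
      exists u, ses_prj s' \c u = x /\ m \c u = y].
Proof.
case: s => E i p ip /=; have [P [a [b [ae ab jm U]]]] := pullback_epi f (se_epi ip).
have [|k [ak bk]] := U K 0 i; first by rewrite mcompm0 se0.
suff ka : short_exact k a by exists (Ses ka), b.
apply: epi_short_exact => //; apply: is_kernelI => //.
  apply/monoP => X x kx; apply: (mono0 (se_mono ip)).
  by rewrite -bk -mcompA kx mcompm0.
move=> X t at0; have [|u uE] := se_lift ip (t := b \c t).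
  by rewrite mcompA -ab -mcompA at0 mcompm0.
exists u; apply/eqP; rewrite -subr_eq0; apply/eqP; apply: jm.
  by rewrite mcompDr mcompmN mcompA ak mcomp0m at0 subrr.
by rewrite mcompDr mcompmN mcompA bk uE subrr.
Qed.

Lemma ses_pushout K C D (s : ses K C) (g : hom K D) :
  exists (s' : ses D C) (m : hom (ses_mid s) (ses_mid s')),
  [/\ m \c ses_inj s = ses_inj s' \c g, ses_prj s' \c m = ses_prj s,
    forall X (x : hom (ses_mid s') X), x \c ses_inj s' = 0 -> x \c m = 0 -> x = 0 &
    forall X (x : hom D X) (y : hom (ses_mid s) X), x \c g = y \c ses_inj s ->
      exists u, u \c ses_inj s' = x /\ u \c m = y].
Proof.
case: s => E i p ip /=; have [P [a [b [am ab je U]]]] := pushout_mono g (se_mono ip).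
have [|k [ka kb]] := U C 0 p; first by rewrite mcomp0m se0.
suff ak : short_exact a k by exists (Ses ak), b.
apply: mono_short_exact => //; apply: is_cokernelI => //.
  apply/epiP => X x xk; apply: (epi0 (se_epi ip)).
  by rewrite -kb mcompA xk mcomp0m.
move=> X t ta; have [|u uE] := se_desc ip (t := t \c b).
  by rewrite -mcompA -ab mcompA ta mcomp0m.
exists u; apply/eqP; rewrite -subr_eq0; apply/eqP; apply: je.
  by rewrite mcompDl mcompNm -mcompA ka mcompm0 ta subrr.
by rewrite mcompDl mcompNm -mcompA kb uE subrr.
Qed.

Lemma image_exists B C (f : hom B C) :
  exists I (p : hom B I) (i : hom I C), [/\ epi p, mono i & i \c p = f].
Proof.
have [K [k fk]] := kernel_exists f; have [I [p kp]] := cokernel_exists k.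
have [i iE] := cokernel_desc kp fk.1; exists I, p, i; split=> //.
  exact: cokernel_epi kp.
(* An element of the image killed by [i] lifts, after a cover, to an element of [B] killed by [f];
   this one comes from the kernel [k], so [p] kills it. *)
apply/monoP => T t it.
have [P [a [b [ae ab _ _]]]] := pullback_epi t (cokernel_epi kp).
have [|u uE] := @kernel_lift _ _ _ _ _ _ b fk.
  by rewrite -iE -mcompA -ab mcompA it mcomp0m.
by apply: (epi0 ae); rewrite ab -uE mcompA kp.1 mcomp0m.
Qed.

End Abelian.

(** * Trivial Yoneda extensions *)

Section NullExtensions.
Variable A : abelianCategory.
Implicit Types B C D K L P T X : A.

(* [null f e] says that the pullback of [e] along [f] is trivial in
   Ext^(n.+1)(T, D): it is killed by successive epimorphisms onto [T] and onto
   the kernels that they produce. *)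
Fixpoint null D n : forall T C : A, hom T C -> extension D n C -> Prop :=
  match n return forall T C : A, hom T C -> extension D n C -> Prop with
  | 0 => fun T C f e => exists l, ses_prj e \c l = f
  | n'.+1 => fun T C f e =>
      exists P L (i : hom L P) (q : hom P T)
        (g : hom P (ses_mid (projT2 e).1)) (f' : hom L (projT1 e)),
      [/\ short_exact i q, ses_prj (projT2 e).1 \c g = f \c q,
          ses_inj (projT2 e).1 \c f' = g \c i & null f' (projT2 e).2]
  end.

(** Unlike [extension_morphism], this lets the [D] end vary, as needed to compare extensions by the
    middle of a short exact sequence with extensions by its quotient. *)
Fixpoint extension_map D D' (d : hom D D') n :
    forall C C' : A, hom C C' -> extension D n C -> extension D' n C' -> Prop :=
  match n return
    forall C C' : A, hom C C' -> extension D n C -> extension D' n C' -> Prop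
  with
  | 0 => fun C C' f e e' => ses_morphism d f e e'
  | n'.+1 => fun C C' f e e' => exists k : hom (projT1 e) (projT1 e'),
      ses_morphism k f (projT2 e).1 (projT2 e').1 /\
      extension_map d k (projT2 e).2 (projT2 e').2
  end.

Lemma extension_morphism_map D n C C' (f : hom C C')
    (e : extension D n C) (e' : extension D n C') :
  extension_morphism f e e' -> extension_map (idm D) f e e'.
Proof.
elim: n C C' f e e' => [|n IHn] C C' f e e' //= [k [sk /IHn ek]].
by exists k.
Qed.

Lemma ses_morphism_id K C (s : ses K C) : ses_morphism (idm K) (idm C) s s.
Proof. by exists (idm _); rewrite !mcomp1m !mcompm1. Qed.

Lemma extension_morphism_id D n C (e : extension D n C) :
  extension_morphism (idm C) e e.
Proof.
elim: n C e => [|n IHn] C e; first exact: ses_morphism_id.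
by exists (idm _); split; [exact: ses_morphism_id | exact: IHn].
Qed.

(** Only the short exact sequence that ends in [C] has to be pulled back, since its kernel does not
    change. *)
Lemma extension_pullback D n T C (f : hom T C) (e : extension D n C) :
  exists e', extension_morphism f e' e.
Proof.
case: n e => [|n] e /=.
  have [s [m [mi mp _]]] := ses_pullback e f.
  by exists s, m; rewrite mcompm1.
case: e => K [s e]; have [s' [m [mi mp _]]] := ses_pullback s f.
exists (existT _ K (s', e)), (idm K); split; last exact: extension_morphism_id.
by exists m; rewrite mcompm1.
Qed.

Lemma ses_lift_diff K C T (s : ses K C) (x y : hom T (ses_mid s)) :
  ses_prj s \c x = ses_prj s \c y -> exists u, ses_inj s \c u = x - y.
Proof.
by move=> xy; apply: (se_lift (ses_exact s)); rewrite mcompDr mcompmN xy subrr.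
Qed.

Lemma null_comp D n S T C (u : hom S T) (f : hom T C) (e : extension D n C) :
  null f e -> null (f \c u) e.
Proof.
elim: n S T C u f e => [|n IHn] S T C u f e /=.
  by case=> l lE; exists (l \c u); rewrite mcompA lE.
case=> P [L [i [q [g [f' [iq gq gi ef]]]]]].
have [s [m [_ mp U]]] := ses_pullback (Ses iq) u.
have [v vE] : exists v, i \c v = m \c ses_inj s.
  apply: (se_lift iq).
  by rewrite mcompA [q \c m]mp -mcompA (se0 (ses_exact s)) mcompm0.
exists _, _, (ses_inj s), (ses_prj s), (g \c m), (f' \c v); split.
- exact: ses_exact.
- by rewrite mcompA gq -!mcompA [q \c m]mp.
- by rewrite mcompA gi -!mcompA vE.
- exact: IHn.
Qed.

(** On the fibre product of the two covers both lifts are defined and can be added; the residual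
    maps on its kernel add up accordingly. *)
Lemma null_add D n T C (f f' : hom T C) (e : extension D n C) :
  null f e -> null f' e -> null (f + f') e.
Proof.
elim: n T C f f' e => [|n IHn] T C f f' e /=.
  by move=> [l lE] [l' lE']; exists (l + l'); rewrite mcompDr lE lE'.
case=> P [L [i [q [g [h [iq gq gi eh]]]]]].
case=> P' [L' [i' [q' [g' [h' [iq' gq' gi' eh']]]]]].
have [Q [a [b [ae ab _ _]]]] := pullback_epi q (se_epi iq').
have [R [j jqa]] := epi_kernel (epi_comp (se_epi iq) ae).
have [v vE] : exists v, i \c v = a \c j.
  by apply: (se_lift iq); rewrite mcompA (se0 jqa).
have [v' vE'] : exists v', i' \c v' = b \c j.
  by apply: (se_lift iq'); rewrite mcompA -ab (se0 jqa).
exists Q, R, j, (q \c a), (g \c a + g' \c b), (h \c v + h' \c v'); split=> //.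
- by rewrite mcompDr !mcompA gq gq' -!mcompA -ab -mcompDl.
- by rewrite mcompDr !mcompA gi gi' -!mcompA vE vE' !mcompA -mcompDl.
- by apply: IHn; apply: null_comp.
Qed.

(** The last middle term is a cover that works: its projection lifts by the identity, and for a
    longer extension the residual map is then zero, out of [zero_ob]. This is why the nullity of
    zero maps is established alongside. *)
Lemma null_zero_cover D n C (e : extension D n C) :
  (forall T, null (0 : hom T C) e) /\
  exists E (p : hom E C), epi p /\ null p e.
Proof.
elim: n C e => [|n IHn] C e /=.
  split=> [T|]; first by exists 0; rewrite mcompm0.
  exists (ses_mid e), (ses_prj e); split; first exact: se_epi (ses_exact e).
  by exists (idm _); rewrite mcompm1.
have [zt zf] := zero_obP A.
have [e0 _] := IHn _ (projT2 e).2.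
have id0 T : short_exact (0 : hom zero_ob T) (idm T).
  by apply: zero_short_exact; [move=> U x y; rewrite !mcomp1m | exact: epi_id].
split=> [T|].
  exists T, zero_ob, 0, (idm T), 0, 0; split=> //.
  - by rewrite mcompm0 mcompm1.
  - by rewrite !mcompm0.
exists (ses_mid (projT2 e).1), (ses_prj (projT2 e).1).
split; first exact: se_epi (ses_exact _).
exists _, zero_ob, 0, (idm _), (idm _), 0; split=> //.
by rewrite !mcompm0.
Qed.

Lemma null0 D n T C (e : extension D n C) : null (0 : hom T C) e.
Proof. by have [] := null_zero_cover e. Qed.

Lemma null_cover D n C (e : extension D n C) :
  exists E (p : hom E C), epi p /\ null p e.
Proof. by have [] := null_zero_cover e. Qed.

Lemma null_pushforward D D' (d : hom D D') n T C C' (f : hom T C) (h : hom C C')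
    (e : extension D n C) (e' : extension D' n C') :
  extension_map d h e e' -> null f e -> null (h \c f) e'.
Proof.
elim: n T C C' f h e e' => [|n IHn] T C C' f h e e' /=.
  move=> [m [mi mp]] [l lE]; exists (m \c l).
  by rewrite mcompA mp -mcompA lE.
move=> [k [[m [mi mp]] ek]] [P [L [i [q [g [f' [iq gq gi ef]]]]]]].
exists P, L, i, q, (m \c g), (k \c f'); split=> //.
- by rewrite mcompA mp -!mcompA gq.
- by rewrite mcompA -mi -!mcompA gi.
- exact: IHn ef.
Qed.

(** A morphism that is the identity on [D] exhibits [s] as the pullback of [s'] along [h].
    Concretely, over the pullback [t] of [s] the two maps to the middle of [s'] differ by some [u]
    into [D] that restricts to minus the identity; correcting [b] by [u] makes it descend to [T]. *)
Lemma ses_morphism_lift D T C C' (f : hom T C) (h : hom C C')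
    (s : ses D C) (s' : ses D C') (l : hom T (ses_mid s')) :
  ses_morphism (idm D) h s s' -> ses_prj s' \c l = h \c f ->
  exists l', ses_prj s \c l' = f.
Proof.
move=> [m [mi mp]] lE; have [t [b [bi bp _]]] := ses_pullback s f.
have [u uE] : exists u, ses_inj s' \c u = l \c ses_prj t - m \c b.
  by apply: ses_lift_diff; rewrite !mcompA lE mp -!mcompA bp.
have ut : u \c ses_inj t = - idm D.
  apply: (se_mono (ses_exact s')).
  rewrite mcompA uE mcompDl mcompNm -!mcompA (se0 (ses_exact t)) mcompm0 bi mi.
  by rewrite mcompmN add0r.
have [x xE] : exists x, x \c ses_prj t = b + ses_inj s \c u.
  apply: (se_desc (ses_exact t)).
  by rewrite mcompDl bi -mcompA ut mcompmN mcompm1 subrr.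
exists x; apply: (se_epi (ses_exact t)).
by rewrite -mcompA xE mcompDr bp mcompA (se0 (ses_exact s)) mcomp0m addr0.
Qed.

(** This is the hard direction of invariance. The cover [P] carries a lift [g] to the middle of [s']
    only; a lift [b] to the middle of [s] needs the further cover [Q], and there [m \c b] and
    [g \c a] need not agree. *)
Lemma null_pullback D n T C C' (f : hom T C) (h : hom C C')
    (e : extension D n C) (e' : extension D n C') :
  extension_morphism h e e' -> null (h \c f) e' -> null f e.
Proof.
elim: n T C C' f h e e' => [|n IHn] T C C' f h /=.
  by move=> s s' ss' [l lE]; apply: ses_morphism_lift ss' lE.
move=> [K [s e]] [K' [s' e']] /= [k [[m [mi mp]] ek]].
move=> [P [L [i [q [g [f' [iq gq gi ef]]]]]]].
have [Q [a [b [ae ab _ _]]]] := pullback_epi (f \c q) (se_epi (ses_exact s)).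
have [u uE] : exists u, ses_inj s' \c u = m \c b - g \c a.
  by apply: ses_lift_diff; rewrite !mcompA mp gq -!mcompA -ab !mcompA.
(* [Q] is refined so that the discrepancy [u] between the two lifts dies. *)
have [E [p [pe pnull]]] := null_cover e'.
have [R [c [r [ce cr _ _]]]] := pullback_epi u pe.
have [S [j jqac]] := epi_kernel (epi_comp (se_epi iq) (epi_comp ae ce)).
have qj : q \c a \c c \c j = 0 by rewrite -(mcompA q) (se0 jqac).
have [v vE] : exists v, i \c v = a \c c \c j.
  by apply: (se_lift iq); rewrite !mcompA.
have [w wE] : exists w, ses_inj s \c w = b \c c \c j.
  by apply: (se_lift (ses_exact s)); rewrite !mcompA -ab -!(mcompA f) qj mcompm0.
exists R, S, j, (q \c (a \c c)), (b \c c), w; split=> //=.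
  by rewrite !mcompA -ab.
apply: (IHn _ _ _ _ k _ e') => //.
(* The first summand is null by the given data, the second because it factors through [p], which
   kills [e']. *)
have -> : k \c w = f' \c v + p \c (r \c j).
  apply: (se_mono (ses_exact s')).
  rewrite mcompDr !mcompA -mi -(mcompA m) wE gi -(mcompA g) vE.
  rewrite -[ses_inj s' \c p \c r]mcompA -cr !mcompA uE !mcompDl !mcompNm.
  by rewrite addrC subrK.
by apply: null_add; apply: null_comp.
Qed.

(** The split sequence represents zero in Ext^1. In higher degrees the middle terms are [D], then
    zeros, then [C], with identities at the two ends. *)
Lemma trivial_extension D n C : exists e : extension D n C, null (idm C) e.
Proof.
case: n => [|n].
  have [P [i1 [i2 [p1 [p2 bi]]]]] := biproduct_exists D C.
  have [e1 e2 e3 e4 e5] := bi.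
  suff ip : short_exact i1 p2 by exists (Ses ip), i2.
  apply: epi_short_exact; last first.
    by apply: (@epi_factor _ _ _ _ _ i2); rewrite e2; apply: epi_id.
  apply: is_kernelI => //.
    by apply/monoP => T t /(congr1 (fun x => p1 \c x)); rewrite mcompA e1 mcomp1m mcompm0.
  move=> T t p2t; exists (p1 \c t).
  by rewrite [RHS](biproduct_eta_to bi) p2t mcompm0 addr0.
have ext0 m : inhabited (extension D m (zero_ob : A)).
  elim: m => [|m [e]].
    have iD : short_exact (idm D) (0 : hom D zero_ob).
      by apply: short_exact_zero; [move=> T g h; rewrite !mcomp1m | apply: epi_id].
    by constructor; exists D (idm D) 0.
  have i0 : short_exact (0 : hom zero_ob zero_ob) (idm (zero_ob : A)).
    by apply: zero_short_exact; [move=> T g h; rewrite !mcomp1m | apply: epi_id].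
  by constructor; exists zero_ob; split=> //; exists zero_ob 0 (idm _).
have [e] := ext0 n.
have iC : short_exact (0 : hom zero_ob C) (idm C).
  by apply: zero_short_exact; [move=> T g h; rewrite !mcomp1m | apply: epi_id].
exists (existT _ (zero_ob : A) (Ses iC, e)).
exists C, zero_ob, 0, (idm C), (idm C), 0; split=> //=.
  by rewrite mcompm0 mcompm0.
exact: null0.
Qed.

(** This encodes Ext^(n+1)(T, D) = 0, with the same shift as [extension]. Quantifying over [f]
    covers all pullbacks to [T] without forming them; by [null_extP] the identity suffices. *)
Definition null_ext n T D := forall C (f : hom T C) (e : extension D n C), null f e.

Lemma null_extP n T D :
  (forall e : extension D n T, null (idm T) e) -> null_ext n T D.
Proof.
move=> nT C f e; have [e' ee'] := extension_pullback f e.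
rewrite -[f]mcompm1.
exact: null_pushforward (extension_morphism_map ee') (nT e').
Qed.

Lemma null_ext_vanishes n T D : Ext_vanishes n T D -> null_ext n T D.
Proof.
move=> vT; apply: null_extP => e; have [e0 e0P] := trivial_extension D n T.
suff : null (idm T) e0 <-> null (idm T) e by move=> <-.
(* The zigzag joining [e] to the trivial extension is followed one morphism at a time, with
   [null_pushforward] in one direction and [null_pullback] in the other. *)
elim: {e0P} (vT e0 e) => {e0 e} [e e' ee'|e //|e e' _ IH|x y z _ -> _ -> //].
  split=> [e0|]; last by rewrite -{1}[idm T]mcompm1; apply: null_pullback ee'.
  rewrite -[idm T]mcompm1.
  exact: null_pushforward (extension_morphism_map ee') e0.
by split; case: IH.
Qed.

Lemma null_ext_zero_l n T D : is_zero T -> null_ext n T D.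
Proof. by case=> _ zf C f e; rewrite (zf _ f); apply: null0. Qed.

Lemma null_ext_zero_r n T D : is_zero D -> null_ext n T D.
Proof.
case=> zt zf; apply: null_extP; elim: n T => [|n IHn] T.
  move=> /= s; have [|l lE] := se_desc (ses_exact s) (t := idm _).
    by rewrite (zf _ (_ \c _)).
  exists l; apply: (se_epi (ses_exact s)).
  by rewrite -mcompA lE mcompm1 mcomp1m.
move=> [K [s e]] /=.
exists _, _, (ses_inj s), (ses_prj s), (idm _), (idm _); split=> //.
- exact: ses_exact.
- by rewrite mcompm1 mcomp1m.
- by rewrite mcompm1 mcomp1m.
Qed.

End NullExtensions.

(** * Dimension shifting *)

Section DimensionShift.
Variable A : abelianCategory.
Implicit Types B C D K L P T X Z : A.

(** With [E] and [F] the middles of [s] and [t], and [F'] that of the pullback [t'], the new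
    sequence is 0 -> F' -> P (+) F -> E -> 0. Its projection is epi because its image contains [Z]
    and maps onto [Z']. The inclusion of [F] shows that [u] restricted to [Z] is [t] pushed along K
    -> F'. *)
Lemma glue_ses K L P Z Z' (t : ses K Z) (s : ses Z Z') (i : hom L P)
    (q : hom P Z') (g : hom P (ses_mid s)) (f' : hom L Z) :
  short_exact i q -> ses_prj s \c g = q -> ses_inj s \c f' = g \c i ->
  exists (t' : ses K L) (u : ses (ses_mid t') (ses_mid s)),
    ses_morphism (idm K) f' t' t /\
    ses_morphism (ses_inj t') (ses_inj s) t u.
Proof.
move=> iq gq gi; have [t' [m [mi mp U]]] := ses_pullback t f'.
have [B [i1 [i2 [p1 [p2 bi]]]]] := biproduct_exists P (ses_mid t).
pose h := g \c p1 + ses_inj s \c ses_prj t \c p2.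
pose k := i1 \c (- (i \c ses_prj t')) + i2 \c m.
have hk : h \c k = 0.
  rewrite mcompDl -!mcompA (biproduct_p1 bi) (biproduct_p2 bi) mp.
  by rewrite mcompmN !mcompA gi addNr.
have he : epi h.
  apply/epiP => X x xh.
  have xg : x \c g = 0.
    by rewrite -(biproduct_i1 bi g (ses_inj s \c ses_prj t)) mcompA xh mcomp0m.
  have xs : x \c ses_inj s = 0.
    apply: (epi0 (se_epi (ses_exact t))).
    by rewrite -mcompA -(biproduct_i2 bi g (ses_inj s \c ses_prj t)) mcompA xh mcomp0m.
  have [y yE] := se_desc (ses_exact s) xs.
  have : y \c q = 0 by rewrite -gq mcompA yE.
  by move/(epi0 (se_epi iq)) => y0; rewrite -yE y0 mcomp0m.
have km : mono k.
  apply/monoP => X x kx.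
  have tx : ses_prj t' \c x = 0.
    apply: (mono0 (se_mono iq)); apply/eqP; rewrite -oppr_eq0 mcompA -mcompNm.
    by rewrite -(biproduct_p1 bi (- (i \c ses_prj t')) m) -mcompA kx mcompm0.
  have mx : m \c x = 0.
    by rewrite -(biproduct_p2 bi (- (i \c ses_prj t')) m) -mcompA kx mcompm0.
  have [y yE] := se_lift (ses_exact t') tx.
  have : ses_inj t \c y = 0 by rewrite -mi -mcompA yE.
  by move/(mono0 (se_mono (ses_exact t))) => y0; rewrite -yE y0 mcompm0.
have kh : short_exact k h.
  apply: epi_short_exact => //; apply: is_kernelI => // X x hx.
  have hxE : g \c (p1 \c x) + ses_inj s \c (ses_prj t \c (p2 \c x)) = 0.
    by rewrite !mcompA -mcompDl.
  have [l lE] : exists l, i \c l = p1 \c x.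
    apply: (se_lift iq); rewrite -gq -mcompA.
    move/(congr1 (fun y => ses_prj s \c y)): hxE.
    rewrite mcompDr (mcompA (ses_prj s) (ses_inj s)) (se0 (ses_exact s)).
    by rewrite mcomp0m addr0 mcompm0.
  have [|u [uL um]] := U X (- l) (p2 \c x).
    apply: (se_mono (ses_exact s)); rewrite mcompmN mcompmN mcompA gi -mcompA lE.
    by apply/eqP; rewrite eq_sym -addr_eq0 addrC hxE.
  exists u; rewrite [RHS](biproduct_eta_to bi) mcompDl -!mcompA um mcompNm -mcompA uL.
  by rewrite !mcompmN opprK lE.
exists t', (Ses kh); split; first by exists m; rewrite mcompm1.
exists i2 => /=; rewrite /h (biproduct_i2 bi); split=> //.
by rewrite mcompDl -!mcompA mcompNm -mcompA (se0 (ses_exact t')) mcompm0 oppr0 mcompm0 add0r mi.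
Qed.

(** This is exactness of the long exact sequence at Ext^(n+1)(Z, D): a class killed by the
    connecting map of [s] extends to the middle of [s]. For [n = 0] the nullity splits [t'], and
    pushing [u] along the retraction onto [D] gives the extension. Otherwise [u] becomes the last
    sequence, and the induction applies to [t']. *)
Lemma extension_glue D n Z Z' (s : ses Z Z') (e : extension D n Z) :
  null (idm Z') (existT _ Z (s, e) : extension D n.+1 Z') ->
  exists e', extension_morphism (ses_inj s) e (e' : extension D n (ses_mid s)).
Proof.
elim: n Z Z' s e => [|n IHn] Z Z' s e.
  move=> [P [L [i [q [g [f' [iq gq gi [l lE]]]]]]]].
  rewrite mcomp1m in gq.
  have [t' [u [t'e [m [mi mp]]]]] := glue_ses e iq gq gi.
  have [r rE] : exists r, ses_prj t' \c r = idm L.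
    by apply: (ses_morphism_lift t'e); rewrite mcompm1; apply: lE.
  have [v vE] : exists v, ses_inj t' \c v = idm _ - r \c ses_prj t'.
    by apply: ses_lift_diff; rewrite mcompm1 mcompA rE mcomp1m.
  have vi : v \c ses_inj t' = idm D.
    apply: (se_mono (ses_exact t')).
    rewrite mcompA vE mcompDl mcompNm -mcompA (se0 (ses_exact t')) mcompm0.
    by rewrite subr0 mcomp1m mcompm1.
  have [u' [m' [mi' mp' _ _]]] := ses_pushout u v.
  exists u', (m' \c m); split.
    by rewrite -mcompA mi mcompA mi' -mcompA vi.
  by rewrite mcompA mp' mp.
case: e => K [t e] [P [L [i [q [g [f' [iq gq gi ef]]]]]]].
rewrite mcomp1m in gq.
have [t' [u [t't tu]]] := glue_ses t iq gq gi.
have [|e' ee'] := IHn _ _ t' e.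
  apply: (@null_pullback _ D n.+1 L L Z (idm L) f' _ (existT _ K (t, e))).
    by exists (idm K); split; [exact: t't | exact: extension_morphism_id].
  by rewrite mcompm1.
by exists (existT _ (ses_mid t' : A) (u, e')), (ses_inj t').
Qed.

Lemma null_ext_kernel n Z Z' D (s : ses Z Z') :
  null_ext n (ses_mid s) D -> null_ext n.+1 Z' D -> null_ext n Z D.
Proof.
move=> nC nZ'; apply: null_extP => e.
have [e' ee'] := extension_glue (nZ' _ (idm _) (existT _ Z (s, e))).
apply: (null_pullback ee'); rewrite mcompm1 -[ses_inj s]mcomp1m.
by apply: null_comp; apply: nC.
Qed.

(** Yoneda composition with [s] at the far end, that is, the connecting map Ext^(n+1)(C, D) ->
    Ext^(n+2)(C, D'). *)
Fixpoint splice D D' (s : ses D' D) n :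
    forall C, extension D n C -> extension D' n.+1 C :=
  match n return forall C, extension D n C -> extension D' n.+1 C with
  | 0 => fun C e => existT _ D (e, s)
  | n'.+1 => fun C e => existT _ (projT1 e) ((projT2 e).1, splice s (projT2 e).2)
  end.

(** The covers that witness nullity are themselves the sequences of the lifted extension. Only the
    innermost one is modified: it is pushed out along the final lift [l] into the middle of [s]. *)
Lemma extension_lift D D' (s : ses D' D) n T C (f : hom T C) (e : extension D n C) :
  null f (splice s e) ->
  exists e' : extension (ses_mid s) n T, extension_map (ses_prj s) f e' e.
Proof.
elim: n T C f e => [|n IHn] T C f e.
  move=> [P [L [i [q [g [f' [iq gq gi [l lE]]]]]]]].

  have [u [m [mi mp je U]]] := ses_pushout (Ses iq) l.
  have [|r [ri rm]] := U _ (ses_inj e \c ses_prj s) g; first by rewrite -mcompA lE.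
  exists u, r; split=> //.
  apply/eqP; rewrite -subr_eq0; apply/eqP; apply: je.
    rewrite mcompDl mcompNm -!mcompA ri (se0 (ses_exact u)) mcompm0 subr0.
    by rewrite mcompA (se0 (ses_exact e)) mcomp0m.
  by rewrite mcompDl mcompNm -!mcompA rm mp gq subrr.
move=> [P [L [i [q [g [f' [iq gq gi /IHn[e' ee']]]]]]]].
exists (existT _ L (Ses iq, e')), f'; split=> //.
by exists g.
Qed.

Lemma null_ext_cokernel n T D D' (s : ses D' D) :
  null_ext n T (ses_mid s) -> null_ext n.+1 T D' -> null_ext n T D.
Proof.
move=> nB nD' C f e; have [e' ee'] := extension_lift (nD' C f (splice s e)).
by rewrite -[f]mcompm1; apply: null_pushforward ee' (nB _ _ _).
Qed.

(** The obstruction to extending [g] is the pushout of [s] along [g], a class in Ext^1; a splitting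
    of it yields a retraction [v] onto [D]. *)
Lemma null_ext_extend K C D (s : ses K C) (g : hom K D) : null_ext 0 C D ->
  exists h, h \c ses_inj s = g.
Proof.
move=> nC; have [u [m [mi mp _ _]]] := ses_pushout s g.
have [r rE] := nC C (idm C) u.
have [v vE] : exists v, ses_inj u \c v = idm _ - r \c ses_prj u.
  by apply: ses_lift_diff; rewrite mcompm1 mcompA rE mcomp1m.
exists (v \c m); apply: (se_mono (ses_exact u)).
rewrite !mcompA vE mcompDl mcompNm mcomp1m mcompDl mcompNm mi.
by rewrite -2!mcompA mi (mcompA (ses_prj u)) (se0 (ses_exact u)) mcomp0m mcompm0 subr0.
Qed.

End DimensionShift.

(** * Exact sequences and cones *)

Section ExactSequences.
Variable A : abelianCategory.
Implicit Types B C D I K M N P T X Z : A.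

(* Exactness in terms of generalized elements: an element killed by [g] comes
   from [f] after passing to an epimorphic cover. *)
Definition exact_at B C D (f : hom B C) (g : hom C D) :=
  g \c f = 0 /\
  forall T (t : hom T C), g \c t = 0 ->
    exists (S : A) (q : hom S T) (u : hom S B), epi q /\ f \c u = t \c q.

Lemma epi_exists_lift B C T (f : hom B C) (t : hom T C) : epi f ->
  exists (S : A) (q : hom S T) (u : hom S B), epi q /\ f \c u = t \c q.
Proof.
by move=> fe; have [S [q [u [qe tq _ _]]]] := pullback_epi t fe; exists S, q, u.
Qed.

Lemma epi_lifts B C (f : hom B C) :
  (forall T (t : hom T C), exists (S : A) (q : hom S T) (u : hom S B),
    epi q /\ f \c u = t \c q) -> epi f.
Proof.
case/(_ _ (idm C)) => S [q [u [qe]]]; rewrite mcomp1m => fu.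
by apply: (@epi_factor _ _ _ _ f u); rewrite fu.
Qed.

Lemma image_cokernel_short_exact B C I Q (f : hom B C) (q : hom C Q)
    (p : hom B I) (i : hom I C) :
  is_cokernel f q -> epi p -> mono i -> i \c p = f -> short_exact i q.
Proof.
move=> fq pe im ipf; apply: (mono_short_exact _ im).
apply: (is_cokernelI _ (cokernel_epi fq)) => [|X x xi].
  by apply: (epi0 pe); rewrite -mcompA ipf fq.1.
by apply: (cokernel_desc fq); rewrite -ipf mcompA xi mcomp0m.
Qed.

Lemma kernel_image_short_exact B C I K (f : hom B C) (j : hom K B)
    (p : hom B I) (i : hom I C) :
  is_kernel f j -> epi p -> mono i -> i \c p = f -> short_exact j p.
Proof.
move=> fj pe im ipf; apply: (epi_short_exact _ pe).
apply: (is_kernelI _ (kernel_mono fj)) => [|X x px].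
  by apply: (mono0 im); rewrite mcompA ipf fj.1.
by apply: (kernel_lift fj); rewrite -ipf -mcompA px mcompm0.
Qed.

Lemma cokernel_exact B C D (f : hom B C) (g : hom C D) :
  is_cokernel f g -> exact_at f g.
Proof.
move=> fg; split=> [|T t gt]; first exact: fg.1.
have [I [p [i [pe im ipf]]]] := image_exists f.
have ig := image_cokernel_short_exact fg pe im ipf.
have [u uE] := se_lift ig gt.
have [S [q [v [qe vE]]]] := epi_exists_lift u pe.
by exists S, q, v; rewrite -ipf -mcompA vE mcompA uE.
Qed.

Lemma exact_kernel B C D I (f : hom B C) (g : hom C D) (p : hom B I) (i : hom I C) :
  exact_at f g -> epi p -> mono i -> i \c p = f -> is_kernel g i.
Proof.
move=> [gf fg] pe im ipf; apply: (is_kernelI _ im) => [|T t gt].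
  by apply: (epi0 pe); rewrite -mcompA ipf.
have [K [c ic]] := cokernel_exists i.
have [S [q [u [qe uE]]]] := fg _ _ gt.
apply: (se_lift (mono_short_exact ic im)); apply: (epi0 qe).
by rewrite -mcompA -uE -ipf !mcompA ic.1 !mcomp0m.
Qed.

Lemma exact_short_exact B C D I J (f : hom B C) (g : hom C D)
    (p : hom B I) (i : hom I C) (q : hom C J) (j : hom J D) :
  exact_at f g -> epi p -> mono i -> i \c p = f -> epi q -> mono j -> j \c q = g ->
  short_exact i q.
Proof.
move=> fg pe im ipf qe jm jqg; apply: epi_short_exact => //.
have ig := exact_kernel fg pe im ipf.
apply: (is_kernelI _ im) => [|T t qt].
  by apply: (mono0 jm); rewrite mcompA jqg ig.1.
by apply: (kernel_lift ig); rewrite -jqg -mcompA qt mcompm0.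
Qed.

Lemma exact_cokernel B C D J (f : hom B C) (g : hom C D) (q : hom C J) (j : hom J D) :
  exact_at f g -> epi q -> mono j -> j \c q = g -> is_cokernel f q.
Proof.
move=> fg qe jm jqg; have [I [p [i [pe im ipf]]]] := image_exists f.
have iq := exact_short_exact fg pe im ipf qe jm jqg.
apply: (is_cokernelI _ qe) => [|T t tf]; first by rewrite -ipf mcompA (se0 iq) mcomp0m.
by apply: (se_desc iq); apply: (epi0 pe); rewrite -mcompA ipf.
Qed.

Lemma mono_is_zero B C (f : hom B C) : mono f -> is_zero C -> is_zero B.
Proof.
move=> fm [zt _]; have id0 : idm B = 0.
  by apply: fm; rewrite (zt _ (f \c _)) (zt _ (f \c 0)).
split=> T t; first by rewrite -[t]mcomp1m id0 mcomp0m.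
by rewrite -[t]mcompm1 id0 mcompm0.
Qed.

(** * Exact sequences ... -> C_1 -> C_0 -> 0 *)

Section LeftSequence.
Variables (C : nat -> A) (d : forall k, hom (C k.+1) (C k)).
Hypotheses (d_epi : epi (d 0)) (d_exact : forall k, exact_at (d k.+1) (d k)).

(** Descending induction on the images, [j] being the distance to the bound: the image of [d k] is
    the cokernel of the image of [d k.+1] in [C k.+1], so [null_ext_cokernel] applies. *)
Lemma null_ext_left_resolution M m :
  (forall k, (m <= k)%N -> is_zero (C k)) ->
  (forall n k, null_ext n M (C k.+1)) -> forall n, null_ext n M (C 0).
Proof.
move=> Cm nC.
have nI j k : (m <= k + j)%N -> exists I (p : hom (C k.+1) I) (i : hom I (C k)),
    [/\ epi p, mono i, i \c p = d k & forall n, null_ext n M I].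
  elim: j k => [|j IHj] k mk; have [I [p [i [pe im ipd]]]] := image_exists (d k);
    exists I, p, i; split=> // n.
    by apply/null_ext_zero_r/(mono_is_zero im)/Cm; rewrite -[k]addn0.
  have [|I' [p' [i' [pe' im' ipd' nI']]]] := IHj k.+1; first by rewrite addSnnS.
  have ip := exact_short_exact (d_exact k) pe' im' ipd' pe im ipd.
  by apply: (null_ext_cokernel (s := Ses ip)) => /=; [apply: nC | apply: nI'].
have [|I [p [i [pe im ipd nI0]]]] := nI m 0; first exact: leq_addl.
(* As [d 0] is epi, its image is all of [C 0]; the last shift only transports the vanishing along
   this isomorphism. *)
have ie : epi i by apply: (@epi_factor _ _ _ _ i p); rewrite ipd.
move=> n; apply: (null_ext_cokernel (s := Ses (zero_short_exact im ie))) => //.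
by apply: null_ext_zero_r; apply: zero_obP.
Qed.

(** Ascending induction on the cokernels [Q] of the differentials: the image of [d k] is the kernel
    of [C k -> Q] and is the next cokernel, so [null_ext_kernel] applies. A map killed by [d k.+1]
    factors through that image, and Ext^1(Q, N) = 0 extends it to [C k]. *)
Lemma hom_left_exact N :
  (forall n k, null_ext n (C k) N) ->
  forall k (f : hom (C k.+1) N), f \c d k.+1 = 0 -> exists f', f' \c d k = f.
Proof.
move=> nC k; have : exists Q (q : hom (C k) Q),
    is_cokernel (d k) q /\ forall n, null_ext n Q N.
  elim: k => [|k [Q [q [dq nQ]]]].
    have [zt zf] := zero_obP A.
    exists zero_ob, 0; split=> [|n]; last by apply: null_ext_zero_l; apply: zero_obP.
    apply: is_cokernelI; first exact: mcomp0m.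
      by move=> T x y _; rewrite (zf _ x) (zf _ y).
    by move=> T t /(epi0 d_epi)->; exists 0; rewrite mcomp0m.
  have [I [p [i [pe im ipd]]]] := image_exists (d k).
  exists I, p; split=> [|n]; first exact: exact_cokernel (d_exact k) pe im ipd.
  have iq := image_cokernel_short_exact dq pe im ipd.
  by apply: (null_ext_kernel (s := Ses iq)) => /=; [apply: nC | apply: nQ].
move=> [Q [q [dq nQ]]] f fd.
have [I [p [i [pe im ipd]]]] := image_exists (d k).
have [h hE] := cokernel_desc (exact_cokernel (d_exact k) pe im ipd) fd.
have iq := image_cokernel_short_exact dq pe im ipd.
have [f' /= f'E] := null_ext_extend (Ses iq) h (nQ 0%N).
by exists f'; rewrite -ipd mcompA f'E.
Qed.

End LeftSequence.

(** * Exact sequences 0 -> C_0 -> C_1 -> .. *)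

Section RightSequence.
Variables (C : nat -> A) (d : forall k, hom (C k) (C k.+1)).
Hypotheses (d_mono : mono (d 0)) (d_exact : forall k, exact_at (d k) (d k.+1)).

Lemma null_ext_right_resolution N m :
  (forall k, (m <= k)%N -> is_zero (C k)) ->
  (forall n k, null_ext n (C k.+1) N) -> forall n, null_ext n (C 0) N.
Proof.
move=> Cm nC.
have nI j k : (m <= k + j)%N -> exists I (p : hom (C k) I) (i : hom I (C k.+1)),
    [/\ epi p, mono i, i \c p = d k & forall n, null_ext n I N].
  elim: j k => [|j IHj] k mk; have [I [p [i [pe im ipd]]]] := image_exists (d k);
    exists I, p, i; split=> // n.
    by apply/null_ext_zero_l/(mono_is_zero im)/Cm/(leq_trans mk); rewrite addn0.
  have [|I' [p' [i' [pe' im' ipd' nI']]]] := IHj k.+1; first by rewrite addSnnS.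
  have ip := exact_short_exact (d_exact k) pe im ipd pe' im' ipd'.
  by apply: (null_ext_kernel (s := Ses ip)) => /=; [apply: nC | apply: nI'].
have [|I [p [i [pe im ipd nI0]]]] := nI m 0; first exact: leq_addl.
have pm : mono p.
  by apply/monoP => T t pt; apply: (mono0 d_mono); rewrite -ipd -mcompA pt mcompm0.
move=> n; apply: (null_ext_kernel (s := Ses (short_exact_zero pm pe))) => //.
by apply: null_ext_zero_l; apply: zero_obP.
Qed.

Lemma hom_right_exact M :
  (forall n k, null_ext n M (C k)) ->
  forall k (f : hom M (C k.+1)), d k.+1 \c f = 0 -> exists f', d k \c f' = f.
Proof.
move=> nC k; have : exists K (i : hom K (C k)),
    is_kernel (d k) i /\ forall n, null_ext n M K.
  elim: k => [|k [K [j [dj nK]]]].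
    have [zt zf] := zero_obP A.
    exists zero_ob, 0; split=> [|n]; last by apply: null_ext_zero_r; apply: zero_obP.
    apply: is_kernelI; first exact: mcompm0.
      by move=> T x y _; rewrite (zt _ x) (zt _ y).
    by move=> T t /(mono0 d_mono)->; exists 0; rewrite mcompm0.
  have [I [p [i [pe im ipd]]]] := image_exists (d k).
  exists I, i; split=> [|n]; first exact: exact_kernel (d_exact k) pe im ipd.
  have jp := kernel_image_short_exact dj pe im ipd.
  by apply: (null_ext_cokernel (s := Ses jp)) => /=; [apply: nC | apply: nK].
move=> [K [j [dj nK]]] f df.
have [I [p [i [pe im ipd]]]] := image_exists (d k).
have [h hE] := kernel_lift (exact_kernel (d_exact k) pe im ipd) df.
have jp := kernel_image_short_exact dj pe im ipd.
have [f' /= f'E] := nK 0%N _ h (Ses jp).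
by exists f'; rewrite -ipd -mcompA f'E.
Qed.

End RightSequence.

(** Biproducts are only known to exist; packing them in a type allows one to be chosen for every
    degree of the cone. *)
Record biproduct_of B C := BiproductOf {
  bp_obj : A;
  bp_i1 : hom B bp_obj; bp_i2 : hom C bp_obj;
  bp_p1 : hom bp_obj B; bp_p2 : hom bp_obj C;
  bpP : is_biproduct bp_i1 bp_i2 bp_p1 bp_p2
}.

Lemma biproduct_inhabited B C : inhabited (biproduct_of B C).
Proof.
have [P [i1 [i2 [p1 [p2 bi]]]]] := biproduct_exists B C.
by constructor; exists P i1 i2 p1 p2.
Qed.

Definition biproduct B C : biproduct_of B C :=
  inhabited_witness (biproduct_inhabited B C).

(* Here [U k] is in degree [k - 1], so that the cone of [phi] is [U k (+) X k]
   in degree [k]; [a 0 : U 1 -> U 0] is zero. *)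
Section Cone.
Variables (U X : nat -> A) (M : A).
Variables (a : forall k, hom (U k.+1) (U k)) (d : forall k, hom (X k.+1) (X k)).
Variables (phi : forall k, hom (U k.+1) (X k)).
Variables (eU : hom (U 1) M) (eX : hom (X 0) M).
Hypotheses (phiP : forall k, phi k \c a k.+1 = d k \c phi k.+1).
Hypotheses (U0 : is_zero (U 0)) (eU_epi : epi eU) (ephi : eX \c phi 0 = eU).
Hypotheses (a_exact : forall k, exact_at (a k.+2) (a k.+1)) (a0_exact : exact_at (a 1) eU).
Hypotheses (d_exact : forall k, exact_at (d k.+1) (d k)) (d0_exact : exact_at (d 0) eX).

Let cone k := bp_obj (biproduct (U k) (X k)).
Let i1 k : hom (U k) (cone k) := bp_i1 _.
Let i2 k : hom (X k) (cone k) := bp_i2 _.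
Let p1 k : hom (cone k) (U k) := bp_p1 _.
Let p2 k : hom (cone k) (X k) := bp_p2 _.
Let bi k : is_biproduct (i1 k) (i2 k) (p1 k) (p2 k) := bpP _.
Let D k : hom (cone k.+1) (cone k) :=
  i1 k \c (- (a k \c p1 k.+1)) + i2 k \c (phi k \c p1 k.+1 + d k \c p2 k.+1).

Let DE k T (u : hom T (U k.+1)) (x : hom T (X k.+1)) :
  D k \c (i1 k.+1 \c u + i2 k.+1 \c x) =
  i1 k \c (- (a k \c u)) + i2 k \c (phi k \c u + d k \c x).
Proof.
rewrite mcompDl -!(mcompA _ _ (i1 _ \c _ + _)) mcompNm mcompDl -!mcompA.
by rewrite (biproduct_p1 (bi _)) (biproduct_p2 (bi _)).
Qed.

Let aa k : a k \c a k.+1 = 0.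
Proof. by case: k => [|k]; [rewrite (U0.1 _ (a 0)) mcomp0m | case: (a_exact k)]. Qed.

Let DD k : D k \c D k.+1 = 0.
Proof.
rewrite DE !mcompmN opprK (mcompA (a k)) aa mcomp0m mcompm0 add0r (mcompDr (d k)).
rewrite (mcompA (phi k)) phiP (mcompA (d k) (phi _)) (mcompA (d k) (d _)).
by rewrite (d_exact k).1 mcomp0m addr0 addNr mcompm0.
Qed.

Let D0_epi : epi (D 0).
Proof.
apply: epi_lifts => T t.
have [S [q [w [qe wE]]]] := epi_exists_lift (eX \c (p2 0 \c t)) eU_epi.
have [|S' [q' [x [qe' xE]]]] := d0_exact.2 _ (p2 0 \c t \c q - phi 0 \c w).
  by rewrite mcompDr mcompmN !mcompA ephi wE !mcompA subrr.
exists S', (q \c q'), (i1 1 \c (w \c q') + i2 1 \c x); split; first exact: epi_comp.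
rewrite DE xE mcompDl mcompNm !mcompA subrKC [RHS](biproduct_eta_to (bi 0)).
by rewrite (U0.1 _ (- _)) (U0.1 _ (p1 0 \c _)) !mcompA.
Qed.

Let D_exact k : exact_at (D k.+1) (D k).
Proof.
split=> // T t; rewrite [t](biproduct_eta_to (bi _)) DE.
move: (p1 _ \c t) (p2 _ \c t) => {t} u x ux.
have au : a k \c u = 0.
  apply/eqP; rewrite -oppr_eq0; apply/eqP.
  by rewrite -[LHS](biproduct_p1 (bi k) _ (phi k \c u + d k \c x)) ux mcompm0.
have pdx : phi k \c u + d k \c x = 0.
  by rewrite -[LHS](biproduct_p2 (bi k) (- (a k \c u))) ux mcompm0.
(* In the lowest degree [a 0 \c u = 0] says nothing, as [U 0] is zero. There [u] is killed by [eU]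
   instead, because [eU \c u = eX \c phi 0 \c u = - eX \c d 0 \c x = 0]. *)
have [S [q [v [qe vE]]]] : exists (S : A) (q : hom S T) (v : hom S (U k.+2)),
    epi q /\ a k.+1 \c v = u \c q.
  case: k => [|k] in u x ux au pdx *; last exact: (a_exact k).2.
  apply: a0_exact.2; rewrite -ephi -mcompA.
  move/eqP: pdx; rewrite addr_eq0 => /eqP->.
  by rewrite mcompmN mcompA d0_exact.1 mcomp0m oppr0.
have [|S' [q' [y [qe' yE]]]] := (d_exact k).2 _ (phi k.+1 \c v + x \c q).
  by rewrite mcompDr !mcompA -phiP -(mcompA (phi k)) vE (mcompA (phi k)) -mcompDl pdx mcomp0m.
exists S', (q \c q'), (i1 _ \c (- (v \c q')) + i2 _ \c y); split; first exact: epi_comp.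
rewrite DE !mcompmN opprK yE mcompDl (mcompA (a _)) vE (mcompA (phi _)) addKr.
by rewrite mcompDl !mcompA.
Qed.

Section Hom.
Variables (Cl : subcategory A) (N : A).
Hypotheses (Cl_N : forall B, Cl B -> forall n, null_ext n B N).
Hypotheses (Cl_U : forall k, Cl (U k)) (Cl_X : forall k, Cl (X k)).

Lemma cone_hom_bottom (x : hom (X 0) N) : x \c d 0 = 0 -> x \c phi 0 = 0 -> x = 0.
Proof.
move=> xd xphi; have : x \c p2 0 \c D 0 = 0.
  rewrite -mcompA /D (biproduct_p2 (bi 0)) mcompDr !mcompA xd xphi.
  by rewrite !mcomp0m addr0.
move/(epi0 D0_epi)=> xp; have [_ e _ _ _] := bi 0.
by rewrite -[x]mcompm1 -e mcompA xp mcomp0m.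
Qed.

(** The hypotheses say that the map with coordinates [u] and [x] is a cocycle of Hom(cone, N), and
    [u'], [x'] are the coordinates of a cochain that bounds it. *)
Lemma cone_hom k (u : hom (U k.+1) N) (x : hom (X k.+1) N) :
  x \c d k.+1 = 0 -> x \c phi k.+1 = u \c a k.+1 ->
  exists u' x', u = x' \c phi k - u' \c a k /\ x = x' \c d k.
Proof.
move=> xd xphi.
have nC n j : null_ext n (cone j) N by apply: Cl_N; apply: sub_biproduct (bi j) _ _.
have [|f fE] := hom_left_exact D0_epi D_exact nC (f := u \c p1 _ + x \c p2 _).
  rewrite mcompDl -!mcompA (biproduct_p1 (bi _)) (biproduct_p2 (bi _)) mcompmN.
  by rewrite mcompDr !mcompA xd xphi mcomp0m addr0 addNr.
exists (f \c i1 _), (f \c i2 _); split.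
  (* The injection is padded with a zero second coordinate, to give it the shape that [DE]
     evaluates. *)
  rewrite -(biproduct_i1 (bi _) u x) -fE -[i1 k.+1]mcompm1 -[i1 k.+1 \c _]addr0.
  rewrite -(mcompm0 _ (i2 k.+1)) -mcompA DE !mcompm0 addr0 mcompDr !mcompm1 mcompmN.
  by rewrite mcompmN addrC !mcompA.
rewrite -(biproduct_i2 (bi _) u x) -fE -[i2 k.+1]mcompm1 -[i2 k.+1 \c _]add0r.
by rewrite -(mcompm0 _ (i1 k.+1)) -mcompA DE !mcompm0 oppr0 mcompm0 !add0r !mcompm1 mcompA.
Qed.

End Hom.
End Cone.

(* Here [Y k] is in degree [- k] and [V k] in degree [1 - k], so that
   [Y k (+) V k] is the cone of [phi] in degree [1 - k]. *)
Section Cocone.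
Variables (Y V : nat -> A) (N : A).
Variables (d : forall k, hom (Y k) (Y k.+1)) (a : forall k, hom (V k) (V k.+1)).
Variables (phi : forall k, hom (Y k) (V k.+1)).
Variables (eY : hom N (Y 0)) (eV : hom N (V 1)).
Hypotheses (phiP : forall k, phi k.+1 \c d k = a k.+1 \c phi k).
Hypotheses (V0 : is_zero (V 0)) (eV_mono : mono eV) (ephi : phi 0 \c eY = eV).
Hypotheses (a_exact : forall k, exact_at (a k.+1) (a k.+2)) (a0_exact : exact_at eV (a 1)).
Hypotheses (d_exact : forall k, exact_at (d k) (d k.+1)) (d0_exact : exact_at eY (d 0)).

Let cone k := bp_obj (biproduct (Y k) (V k)).
Let i1 k : hom (Y k) (cone k) := bp_i1 _.
Let i2 k : hom (V k) (cone k) := bp_i2 _.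
Let p1 k : hom (cone k) (Y k) := bp_p1 _.
Let p2 k : hom (cone k) (V k) := bp_p2 _.
Let bi k : is_biproduct (i1 k) (i2 k) (p1 k) (p2 k) := bpP _.
Let D k : hom (cone k) (cone k.+1) :=
  i1 k.+1 \c (- (d k \c p1 k)) + i2 k.+1 \c (phi k \c p1 k + a k \c p2 k).

Let DE k T (y : hom T (Y k)) (v : hom T (V k)) :
  D k \c (i1 k \c y + i2 k \c v) =
  i1 k.+1 \c (- (d k \c y)) + i2 k.+1 \c (phi k \c y + a k \c v).
Proof.
rewrite mcompDl -!(mcompA _ _ (i1 _ \c _ + _)) mcompNm mcompDl -!mcompA.
by rewrite (biproduct_p1 (bi _)) (biproduct_p2 (bi _)).
Qed.

Let aa k : a k.+1 \c a k = 0.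
Proof. by case: k => [|k]; [rewrite (V0.2 _ (a 0)) mcompm0 | case: (a_exact k)]. Qed.

Let DD k : D k.+1 \c D k = 0.
Proof.
rewrite [X in D _ \c X]/D DE !mcompmN opprK (mcompA (d _)) (d_exact k).1.
rewrite mcomp0m mcompm0 add0r (mcompDr (a _)) (mcompA (phi _)) phiP.
by rewrite (mcompA (a _) (phi _)) (mcompA (a _) (a _)) aa mcomp0m addr0 addNr mcompm0.
Qed.

Let D_lift k T (y : hom T (Y k)) (v : hom T (V k)) :
  D k \c (i1 k \c y + i2 k \c v) = 0 -> d k \c y = 0 /\ phi k \c y + a k \c v = 0.
Proof.
rewrite DE => yv; split.
  apply/eqP; rewrite -oppr_eq0; apply/eqP.
  by rewrite -[LHS](biproduct_p1 (bi k.+1) _ (phi k \c y + a k \c v)) yv mcompm0.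
by rewrite -[LHS](biproduct_p2 (bi k.+1) (- (d k \c y))) yv mcompm0.
Qed.

Let D0_mono : mono (D 0).
Proof.
apply/monoP => T t; rewrite [t](biproduct_eta_to (bi _)).
move: (p1 _ \c t) (p2 _ \c t) => {t} y v /D_lift[dy pv].
have v0 : v = 0 by rewrite (V0.1 _ v).
have [S [q [m [qe mE]]]] := d0_exact.2 _ _ dy.
have m0 : m = 0.
  apply: (mono0 eV_mono); rewrite -ephi -mcompA mE.
  by move: pv; rewrite v0 mcompm0 addr0 mcompA => ->; rewrite mcomp0m.
have y0 : y = 0 by apply: (epi0 qe); rewrite -mE m0 mcompm0.
by rewrite v0 y0 !mcompm0 addr0.
Qed.

Let D_exact k : exact_at (D k) (D k.+1).
Proof.
split=> // T t; rewrite [t](biproduct_eta_to (bi _)).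
move: (p1 _ \c t) (p2 _ \c t) => {t} y v /D_lift[dy pv].
have [S [q [z [qe zE]]]] := (d_exact k).2 _ _ dy.
have az : a k.+1 \c (phi k \c z + v \c q) = 0.
  by rewrite mcompDr !mcompA -phiP -(mcompA (phi _)) zE (mcompA (phi _)) -mcompDl pv mcomp0m.
(* At the start, exactness only gives [phi 0 \c z + v \c q = eV \c m] on a cover. Subtracting
   [eY \c m] from [z] leaves its differential unchanged and cancels this term, since
   [phi 0 \c eY = eV]; so [w = 0] works. In later degrees [z] is kept. *)
have [S' [q' [z' [w [qe' zE' wE]]]]] : exists (S' : A) (q' : hom S' S)
    (z' : hom S' (Y k)) (w : hom S' (V k)),
    [/\ epi q', d k \c z' = d k \c z \c q' &
      a k \c w = phi k \c z' + v \c q \c q'].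
  case: k => [|k] in y v dy pv z zE az *.
    have [S' [q' [m [qe' mE]]]] := a0_exact.2 _ _ az.
    exists S', q', (z \c q' - eY \c m), 0; split=> //.
      by rewrite mcompDr mcompmN !mcompA d0_exact.1 mcomp0m subr0.
    rewrite mcompm0 mcompDr mcompmN [phi 0 \c (eY \c m)]mcompA ephi mE mcompDl.
    by rewrite mcompA opprD addNKr addNr.
  have [S' [q' [w [qe' wE]]]] := (a_exact k).2 _ _ az.
  by exists S', q', (z \c q'), w; split=> //; rewrite ?wE ?mcompDl !mcompA.
exists S', (q \c q'), (i1 _ \c (- z') + i2 _ \c w); split; first exact: epi_comp.
rewrite DE !mcompmN opprK zE' wE addKr zE.
by rewrite mcompDl !mcompA.
Qed.

Section Hom.
Variables (Cl : subcategory A) (M : A).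
Hypotheses (Cl_M : forall B, Cl B -> forall n, null_ext n M B).
Hypotheses (Cl_Y : forall k, Cl (Y k)) (Cl_V : forall k, Cl (V k)).

Lemma cocone_hom_top (y : hom M (Y 0)) : d 0 \c y = 0 -> phi 0 \c y = 0 -> y = 0.
Proof.
move=> dy py; have : D 0 \c (i1 0 \c y + i2 0 \c 0) = 0.
  by rewrite DE dy py oppr0 !(mcompm0, addr0).
move/(mono0 D0_mono) => iy.
by rewrite -(biproduct_p1 (bi 0) y 0) iy mcompm0.
Qed.

Lemma cocone_hom k (y : hom M (Y k.+1)) (v : hom M (V k.+1)) :
  d k.+1 \c y = 0 -> phi k.+1 \c y + a k.+1 \c v = 0 ->
  exists y' v', y = - (d k \c y') /\ v = phi k \c y' + a k \c v'.
Proof.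
move=> dy pv.
have nC n j : null_ext n M (cone j) by apply: Cl_M; apply: sub_biproduct (bi j) _ _.
have [|f fE] := hom_right_exact D0_mono D_exact nC (f := i1 _ \c y + i2 _ \c v).
  by rewrite DE dy pv oppr0 !mcompm0 addr0.
exists (p1 _ \c f), (p2 _ \c f).
move: fE; rewrite [f in D k \c f](biproduct_eta_to (bi _)) DE => fE.
split; first by rewrite -[LHS](biproduct_p1 (bi k.+1) y v) -fE (biproduct_p1 (bi _)).
by rewrite -[LHS](biproduct_p2 (bi k.+1) y v) -fE (biproduct_p2 (bi _)).
Qed.

End Hom.
End Cocone.
End ExactSequences.

(** * Homology of Hom complexes *)

Section HomologyIso.
Variables (G H : abComplex) (f : abMap G H) (n : int).

Lemma homology_eq (K : abComplex) (x y : hcycle K n) :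
  \pi_({ideal_quot @is_boundary K n}) x = \pi_({ideal_quot @is_boundary K n}) y <->
  exists z : K (n + 1), ab_diff K (n + 1) n z = val x - val y.
Proof.
split=> [/eqP|xy]; last apply/eqP; rewrite -Quotient.idealrBE unfold_in.
  by move=> /asboolP[z zE]; exists z; rewrite zE raddfB.
by apply/asboolP; case: xy => z zE; exists z; rewrite zE raddfB.
Qed.

Lemma homology_map_isomorphism :
  (forall (x : G n) (y : H (n + 1)), ab_diff G n (n - 1) x = 0 ->
     f n x = ab_diff H (n + 1) n y -> exists z, ab_diff G (n + 1) n z = x) ->
  (forall y : H n, ab_diff H n (n - 1) y = 0 ->
     exists (x : G n) (z : H (n + 1)),
       ab_diff G n (n - 1) x = 0 /\ ab_diff H (n + 1) n z = f n x - y) ->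
  zmod_isomorphism (homology_map f n).
Proof.
move=> finj fsurj; set h := homology_map f n.
have pi0 K : 0 = \pi_({ideal_quot @is_boundary K n}) 0 by rewrite raddf0.
have val0 K : val (0 : hcycle K n) = 0 by apply: raddf0.
have h_inj : injective h.
  apply: raddf_inj => u; rewrite -[u]reprK /h /= homology_funE pi0 => /homology_eq[z zE].
  rewrite pi0; apply/homology_eq.
  have /eqP xn := valP (repr u).
  have [|w wE] := finj (val (repr u)) z xn; first by rewrite zE val0 subr0.
  by exists w; rewrite wE val0 subr0.
have h_surj v : exists u, h u = v.
  have /eqP yn := valP (repr v); have [x [z [xn zE]]] := fsurj _ yn.
  have xc : x \in @is_cycle G n by rewrite unfold_in xn.
  exists (\pi_({ideal_quot @is_boundary G n}) (HCycle xc)); rewrite -[v]reprK /h /= homology_funE.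
  by apply/homology_eq; exists z.
pose g v := projT1 (cid (h_surj v)).
have gK : cancel g h by move=> v; rewrite /g; case: cid.
have hK : cancel h g by move=> u; apply: h_inj; rewrite gK.
have gB : zmod_morphism g by apply: can2_zmod_morphism hK gK.
by exists (HB.pack_for {additive _ -> _} g (GRing.isZmodMorphism.Build _ _ g gB)).
Qed.

End HomologyIso.

(** * Resolutions as exact sequences, and the comparison maps *)

Section Resolutions.
Variable A : abelianCategory.
Implicit Types (B M N : A) (C : subcategory A).

Lemma homology_zero_exact (B C D Z H : A) (f : hom B C) (g : hom C D)
    (z : hom Z C) (p : hom Z H) :
  is_zero H -> homology_presentation f g z p -> exact_at f g.
Proof.
move=> [H0 _] [gz [f' [zf fp]]].
have f'e : epi f'.
  apply/epiP => T t /(cokernel_desc fp)[u <-].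
  by rewrite (H0 _ p) mcompm0.
split=> [|T t /(kernel_lift gz)[u <-]]; first by rewrite -zf mcompA gz.1 mcomp0m.
have [S [q [v [qe vE]]]] := epi_exists_lift u f'e.
by exists S, q, v; rewrite -zf -mcompA vE mcompA.
Qed.

Lemma resolution_exact C M (R : resolution C M) (k : nat) :
  exact_at (diff R k.+2 k.+1) (diff R k.+1 k).
Proof.
have [Z [z [p]]] := res_acyclic R (n := k.+1%:Z) isT.
have -> : k.+1%:Z + 1 = k.+2 by rewrite -[k.+2]addn1 PoszD.
have -> : k.+1%:Z - 1 = k by rewrite -addn1 PoszD addrK.
by apply: homology_zero_exact; apply: zero_obP.
Qed.

Lemma res_aug_exact C M (R : resolution C M) :
  exact_at (diff R 1 0) (res_aug R) /\ epi (res_aug R).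
Proof.
have [Z [z [zk [f' [zf fe]]]]] := res_H0 R; split; last first.
  exact: epi_factor (cokernel_epi fe).
split=> [|T t et]; first exact: res_augK.
(* The term in degree -1 is zero, so every element of degree 0 is a cycle. *)
have [u uE] : exists u, z \c u = t.
  by apply: (kernel_lift zk); have [zt _] := res_neg R (-1) isT; rewrite (zt _ (_ \c _)).
have [|S [q [v [qe vE]]]] := (cokernel_exact fe).2 _ u; first by rewrite -mcompA uE.
by exists S, q, v; rewrite -zf -mcompA vE mcompA uE.
Qed.

Lemma coresolution_exact C N (R : coresolution C N) (k : nat) :
  exact_at (diff R (- k%:Z) (- k.+1%:Z)) (diff R (- k.+1%:Z) (- k.+2%:Z)).
Proof.
have [Z [z [p]]] := cores_acyclic R (n := - k.+1%:Z) isT.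
have -> : - k.+1%:Z + 1 = - k%:Z by rewrite -addn1 PoszD opprD addrNK.
have -> : - k.+1%:Z - 1 = - k.+2%:Z by rewrite -[k.+2]addn1 PoszD opprD.
by apply: homology_zero_exact; apply: zero_obP.
Qed.

Lemma cores_aug_exact C N (R : coresolution C N) :
  exact_at (cores_aug R) (diff R 0 (- 1)) /\ mono (cores_aug R).
Proof.
have [Z [z [p [s [[zk [f' [zf fp]]] zs ps]]]]] := cores_H0 R.
(* The term in degree 1 is zero, so there are no boundaries and [p] is an isomorphism with inverse
   [s]. Hence the augmentation is a kernel of the first differential. *)
have [_ zf1] := cores_pos R 1 isT.
have [v vp] : exists v, v \c p = idm Z.
  by apply: (cokernel_desc fp); rewrite (zf1 _ f') mcompm0.
have sp : s \c p = idm Z by have <- : v = s; [rewrite -[v]mcompm1 -ps mcompA vp mcomp1m |].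
split; last first.
  apply/monoP => T t; rewrite -zs -mcompA => /(mono0 (kernel_mono zk)) st.
  by rewrite -[t]mcomp1m -ps -mcompA st mcompm0.
split=> [|T t /(kernel_lift zk)[u uE]]; first exact: cores_augK.
exists T, (idm T), (p \c u); split; first exact: epi_id.
by rewrite -zs mcompm1 -mcompA [s \c _]mcompA sp mcomp1m.
Qed.

Lemma null_ext_res_hat C M N :
  (forall B, C B -> forall n, null_ext n M B) -> res_hat C N ->
  forall n, null_ext n M N.
Proof.
move=> CM [R [m Rm]].
pose S k := if k is k'.+1 then R k'%:Z else N.
pose d k : hom (S k.+1) (S k) :=
  if k is k'.+1 return hom (S k.+1) (S k) then diff R k'.+1 k' else res_aug R.
have [aug_exact aug_epi] := res_aug_exact R.
(* One unit of the bound accounts for [N] sitting at index 0, the other for the strict inequality in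
   [bounded]; the absolute value is there because [m] may be negative. *)
apply: (@null_ext_left_resolution _ S d _ _ M `|m|.+2) => //.
- by case=> [|k]; [exact: aug_exact | exact: resolution_exact].
- case=> [|k] // mk; apply: Rm.
  by apply: le_lt_trans (ler_norm m) _; rewrite ltz_nat.
- by move=> n k; apply: CM; apply: res_mem.
Qed.

Lemma null_ext_cores_hat C M N :
  (forall B, C B -> forall n, null_ext n B N) -> cores_hat C M ->
  forall n, null_ext n M N.
Proof.
move=> CN [R [m Rm]].
pose S k := if k is k'.+1 then R (- k'%:Z) else M.
pose d k : hom (S k) (S k.+1) :=
  if k is k'.+1 return hom (S k) (S k.+1) then diff R (- k'%:Z) (- k'.+1%:Z)
  else cores_aug R.
have [aug_exact aug_mono] := cores_aug_exact R.
apply: (@null_ext_right_resolution _ S d _ _ N `|m|.+2) => //.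
- by case=> [|k]; [exact: aug_exact | exact: coresolution_exact].
- case=> [|k] // mk; apply: Rm; rewrite normrN.
  by apply: le_lt_trans (ler_norm m) _; rewrite ltz_nat.
- by move=> n k; apply: CN; apply: cores_mem.
Qed.

Lemma perp_null_ext (C D : subcategory A) : perp C D ->
  forall B E, C B -> D E -> forall n, null_ext n B E.
Proof. by move=> CD B E CB DE n; apply: null_ext_vanishes; apply: CD. Qed.

Section Comparison.
Variables (W X : subcategory A) (M N : A).
Variables (RW : proper_resolution W M) (RX : proper_resolution X M).
Variable phi : comparison RW RX.
Hypotheses (WX : subcat_incl W X).
Hypothesis XN : forall B, X B -> forall n, null_ext n B N.

(** This is [k - 1], defined by cases so that [prev k.+1] reduces to [k] and no transport between
    Hom groups is needed. *)
Let prev (k : nat) : int := if k is k'.+1 then Posz k' else Negz 0.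
Let U k : A := RW (prev k).
Let a k : hom (U k.+1) (U k) := diff RW (prev k.+1) (prev k).
Let Y (k : nat) : A := RX k.
Let d (k : nat) : hom (Y k.+1) (Y k) := diff RX k.+1 k.
Let psi (k : nat) : hom (U k.+1) (Y k) := phi k.

Let psiP k : psi k \c a k.+1 = d k \c psi k.+1.
Proof. exact: chain_mapP. Qed.

Let U0 : is_zero (U 0).
Proof. exact: (res_neg RW (-1) isT). Qed.

Lemma comparison_hom_bottom (x : hom (RX 0) N) :
  x \c diff RX 1 0 = 0 -> x \c phi 0 = 0 -> x = 0.
Proof.
have [W0 We] := res_aug_exact RW; have [X0 _] := res_aug_exact RX.
apply: (@cone_hom_bottom _ U Y M a d psi (res_aug RW) (res_aug RX)) => //.
exact: cmp_aug.
Qed.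

Lemma comparison_hom k (u : hom (RW (prev k.+1)) N) (x : hom (RX k.+1) N) :
  x \c diff RX k.+2 k.+1 = 0 -> x \c phi k.+1 = u \c diff RW k.+1 k ->
  exists (u' : hom (RW (prev k)) N) (x' : hom (RX k) N),
    u = x' \c phi k - u' \c diff RW k (prev k) /\ x = x' \c diff RX k.+1 k.
Proof.
have [W0 We] := res_aug_exact RW; have [X0 _] := res_aug_exact RX.
apply: (@cone_hom _ U Y M a d psi (res_aug RW) (res_aug RX) psiP U0 We
  (cmp_aug phi) _ W0 _ X0 X N XN).
- by move=> j; apply: resolution_exact.
- by move=> j; apply: resolution_exact.
- by move=> j; apply: WX; apply: res_mem.
- by move=> j; apply: res_mem.
Qed.

Lemma prevE (k : nat) : prev k = k%:Z - 1.
Proof. by case: k => [|k] //=; rewrite -addn1 PoszD addrK. Qed.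

Lemma theta_res_isomorphism n : zmod_isomorphism (theta_res phi N n).
Proof.
have e1 m : - (m - 1) = - m + 1 :> int by rewrite opprD opprK.
have e2 m : - (m + 1) = - m - 1 :> int by rewrite opprD.
have e3 (k : nat) : k%:Z + 1 = k.+1 by rewrite -addn1 PoszD.
(* The index of the Hom complex is generalized first; its opposite [b] is then the degree in the
   resolutions, which vanish for [b < 0]. *)
apply: homology_map_isomorphism; rewrite /= /precomp; move: (- n) => {}n;
  rewrite e1 e2; move: (- n) => b.
  case: b => [k|k]; last first.
    have [_ zf] := res_neg RX (Negz k) isT.
    by move=> x y _ _; exists 0; rewrite mcomp0m (zf _ x).
  rewrite e3 -prevE; case: k => [|k] x y xd xphi.
    exists 0; rewrite mcomp0m; apply/esym/comparison_hom_bottom => //.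
    by rewrite xphi (U0.2 _ y) mcomp0m.
  have [u' [x' [_ xE]]] := comparison_hom xd xphi.
  by exists x'.
case: b => [k|k]; last first.
  have [_ zf] := res_neg RW (Negz k) isT.
  move=> y _; exists 0, 0; rewrite !mcomp0m (zf _ y).
  by split; rewrite ?subrr.
rewrite e3 -prevE => y yd.
(* Exactness at the cocycle with coordinates [y] and 0: then [x'] is a cocycle, and its image
   differs from [y] by the coboundary of [u']. *)
have [||u' [x' [yE xE]]] := @comparison_hom k y 0; first exact: mcomp0m.
  by rewrite mcomp0m yd.
exists x', u'; split=> //.
by rewrite yE opprB addrC subrK.
Qed.

End Comparison.

Section Cocomparison.
Variables (Y V : subcategory A) (M N : A).
Variables (RY : proper_coresolution Y N) (RV : proper_coresolution V N).
Variable phi : cocomparison RY RV.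
Hypotheses (VY : subcat_incl V Y).
Hypothesis MY : forall B, Y B -> forall n, null_ext n M B.

(** This is [1 - k], by cases so that [next k.+1] reduces to [- k]. *)
Let next (k : nat) : int := if k is k'.+1 then - k'%:Z else 1.
Let S (k : nat) : A := RY (- k%:Z).
Let U k : A := RV (next k).
Let d (k : nat) : hom (S k) (S k.+1) := diff RY (- k%:Z) (- k.+1%:Z).
Let a k : hom (U k) (U k.+1) := diff RV (next k) (next k.+1).
Let psi (k : nat) : hom (S k) (U k.+1) := phi (- k%:Z).

Let psiP k : psi k.+1 \c d k = a k.+1 \c psi k.
Proof. exact: chain_mapP. Qed.

Let U0 : is_zero (U 0).
Proof. exact: (cores_pos RV 1 isT). Qed.

Lemma cocomparison_hom_top (y : hom M (RY 0)) :
  diff RY 0 (- 1) \c y = 0 -> phi 0 \c y = 0 -> y = 0.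
Proof.
have [V0 Vm] := cores_aug_exact RV; have [Y0 _] := cores_aug_exact RY.
apply: (@cocone_hom_top _ S U N d a psi (cores_aug RY) (cores_aug RV)) => //.
exact: cocmp_aug.
Qed.

Lemma cocomparison_hom k (y : hom M (RY (- k.+1%:Z))) (v : hom M (RV (next k.+1))) :
  diff RY (- k.+1%:Z) (- k.+2%:Z) \c y = 0 ->
  phi (- k.+1%:Z) \c y + diff RV (- k%:Z) (- k.+1%:Z) \c v = 0 ->
  exists (y' : hom M (RY (- k%:Z))) (v' : hom M (RV (next k))),
    y = - (diff RY (- k%:Z) (- k.+1%:Z) \c y') /\
    v = phi (- k%:Z) \c y' + diff RV (next k) (- k%:Z) \c v'.
Proof.
have [V0 Vm] := cores_aug_exact RV; have [Y0 _] := cores_aug_exact RY.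
apply: (@cocone_hom _ S U N d a psi (cores_aug RY) (cores_aug RV) psiP U0 Vm
  (cocmp_aug phi) _ V0 _ Y0 Y M MY).
- by move=> j; apply: coresolution_exact.
- by move=> j; apply: coresolution_exact.
- by move=> j; apply: cores_mem.
- by move=> j; apply: VY; apply: cores_mem.
Qed.

Lemma nextE (k : nat) : next k = - k%:Z + 1.
Proof. by case: k => [|k] //=; rewrite -addn1 PoszD opprD addrNK. Qed.

Lemma theta_cores_isomorphism n : zmod_isomorphism (theta_cores M phi n).
Proof.
have e1 (k : nat) : - k%:Z - 1 = - k.+1%:Z by rewrite -addn1 PoszD opprD.
apply: homology_map_isomorphism; rewrite /= /postcomp; move: (- n) => {}n.
  have [[k ->]|[k ->]] : (exists k : nat, n = - k%:Z) \/ (exists k : nat, n = k.+1).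
    by case: n => [[|k]|k]; [left; exists 0%N | right; exists k | left; exists k.+1].
    rewrite e1 -nextE; case: k => [|k] y v dy pv.
      exists 0; rewrite mcompm0; apply/esym/cocomparison_hom_top => //.
      by rewrite pv (U0.1 _ v) mcompm0.
    (* The cone relation is a sum equal to zero while [pv] is an equality of two terms, hence the
       sign on [v]. *)
    have [|y' [v' [yE _]]] := @cocomparison_hom k y (- v) dy.
      by rewrite mcompmN pv subrr.
    by exists (- y'); rewrite mcompmN yE.
  have [zt _] := cores_pos RY k.+1 isT.
  by move=> y v _ _; exists 0; rewrite mcompm0 (zt _ y).
have [[k ->]|[k ->]] : (exists k : nat, n = - k%:Z) \/ (exists k : nat, n = k.+1).
  by case: n => [[|k]|k]; [left; exists 0%N | right; exists k | left; exists k.+1].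
  rewrite e1 -nextE => v dv.
  have [||y' [v' [yE vE]]] := @cocomparison_hom k 0 v; first exact: mcompm0.
    by rewrite mcompm0 add0r dv.
  exists y', (- v'); split; first by apply/eqP; rewrite -oppr_eq0 -yE.
  by rewrite mcompmN vE opprD addNKr.
have [zt _] := cores_pos RV k.+1 isT.
move=> v _; exists 0, 0; rewrite !mcompm0 (zt _ v).
by split; rewrite ?subrr.
Qed.

End Cocomparison.
End Resolutions.

Theorem proposition4p10 (A : abelianCategory) (W X V Y : subcategory A)
  (subWX : subcat_incl W X) (subVY : subcat_incl V Y)
  (perpXW : perp X W) (perpVY : perp V Y) (M N : A) :
  (res_tilde X M -> res_tilde W M -> res_hat W N ->
    forall (RW : proper_resolution W M) (RX : proper_resolution X M)
           (phi : comparison RW RX) (n : int),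
      zmod_isomorphism (theta_res phi N n))
  /\
  (cores_hat V M -> cores_tilde Y N -> cores_tilde V N ->
    forall (RY : proper_coresolution Y N) (RV : proper_coresolution V N)
           (phi : cocomparison RY RV) (n : int),
      zmod_isomorphism (theta_cores M phi n)).
Proof.
split=> [_ _ N_hat RW RX phi n | M_hat _ _ RY RV phi n].
  (* Since [W] lies in [X], all terms of the cone lie in [X]; it remains to see that Ext from
     objects of [X] to [N] vanishes in positive degrees. *)
  apply: theta_res_isomorphism subWX _ n => B XB.
  by apply: null_ext_res_hat N_hat => E WE; apply: perp_null_ext perpXW _ _ XB WE.
apply: theta_cores_isomorphism subVY _ n => B YB.
by apply: null_ext_cores_hat M_hat => E VE; apply: perp_null_ext perpVY _ _ VE YB.
Qed.
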